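(* Let $n \ge 1$ and $m \ge 1$ be integers, and let $A$ be a symmetric $n \times n$ matrix with entries in the polynomial ring $\mathbb{R}[x_1,\ldots,x_m]$. Suppose that for every $(c_1,\ldots,c_m) \in \mathbb{R}^m$ the real matrix obtained from $A$ by substituting $x_i = c_i$ for $i=1,\ldots,m$ is positive semidefinite. Then $A$ can be expressed as a sum of squares of symmetric matrices with entries in the field of rational functions $\mathbb{R}(x_1,\ldots,x_m)$; that is, there exist finitely many symmetric $n\times n$ matrices $B_1,\ldots,B_k$ with entries in $\mathbb{R}(x_1,\ldots,x_m)$ such that $A = B_1^2 + \cdots + B_k^2$.
   Context: A real matrix is positive semidefinite if it is symmetric with all eigenvalues nonnegative. *)

(* Defs.v *)
From HB Require Import structures.
From mathcomp Require Import all_boot all_order all_algebra.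
From mathcomp Require Import reals.
Set Implicit Arguments.
Unset Strict Implicit.
Unset Printing Implicit Defensive.
Import Order.TTheory GRing.Theory Num.Theory.
Local Open Scope ring_scope.

Definition symmetric_mx (K : Type) (n : nat) (M : 'M[K]_n) : Prop := M^T = M.

(* The eigenvalues considered are the real ones; for a symmetric real matrix
   these are all its complex eigenvalues. *)
Definition psd_mx (R : realType) (n : nat) (M : 'M[R]_n) : Prop :=
  symmetric_mx M /\ forall a : R, eigenvalue M a -> 0 <= a.

(* Main.v *)
(* Every polynomial nonnegative on R^m is a sum of squares of rational functions
   (Artin). Otherwise the sums of squares and -f generate a preordering of
   L = R(x_1,...,x_m). Restrict it to the countable subfield K generated by the
   variables and the coefficients of f, and extend it by Zorn's lemma to a maximal
   cone T in an algebraic closure of K: then T - T is a real closed field M in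
   which f is negative at the point (x_1,...,x_m). The coefficients of f satisfy
   the same sign conditions in R and in M, so quantifier elimination transfers
   this point to some c in R^m with f(c) < 0. Quantifier elimination is proved
   semantically, following Cohen and Hormander: the sign diagram of a family of
   univariate polynomials is determined by the diagram of derivatives and
   pseudo-remainders of smaller degree.

   For matrices, symmetric elimination with positive pivots, which are sums of
   squares by Artin's theorem, writes A as a sum of matrices w^T w. Since
   (w^T w)^2 = |w|^2 w^T w and 1/|w|^2 is itself a sum of squares, each w^T w is a
   sum of squares of symmetric matrices. *)
Require Import Defs.
From HB Require Import structures.
From mathcomp Require Import all_boot all_order all_algebra.
From mathcomp Require Import reals mpoly.
From mathcomp Require Import boolp classical_sets closed_field.
From mathcomp Require Import polyorder polyrcf complex.
From mathcomp Require Import zify ring lra.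
Set Implicit Arguments.
Unset Strict Implicit.
Unset Printing Implicit Defensive.
Import Order.TTheory GRing.Theory Num.Theory.
Local Open Scope ring_scope.

(** * Signs of one polynomial over a real closed field *)

Section OneRcf.
Variable N : rcfType.
Implicit Types (p q : {poly N}) (t u v w r s : N).

(** [t] and [u] lie in the same cell of the line cut at the roots of [q]; for [q = 0] this forces
    [t = u]. *)
Definition same_pos q t u := forall s, root q s -> Num.sg (t - s) = Num.sg (u - s).

Lemma sgr_between t u v s : t <= u <= v -> 
  Num.sg (t - s) = Num.sg (v - s) -> Num.sg (t - s) = Num.sg (u - s).
Proof.
move=> /andP[tu uv].
case: (sgrP (t-s)); case: (sgrP (u-s)); case: (sgrP (v-s)) => //; lra.
Qed.

Lemma same_pos_sym q t u : same_pos q t u -> same_pos q u t.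
Proof. by move=> h s /h. Qed.

Lemma same_pos_sg p t u : same_pos p t u -> Num.sg p.[t] = Num.sg p.[u].
Proof.
wlog tu : t u / t <= u.
  by move=> H h; case: (lerP t u) => [/H|/ltW /H H']; [exact| rewrite H' // => s /h].
move=> h; have [->//|tu'] := eqVneq t u.
apply: (@polyrN0_itv _ `[t, u]); rewrite ?in_itv /= ?lexx ?tu //.
move=> s; rewrite in_itv /= => /andP[ts su]; apply/negP => /h.
move: tu'; rewrite -subr_eq0 => /eqP.
case: (sgrP (t-s)); case: (sgrP (u-s)) => //; lra.
Qed.

(** The mean value point lies between [t] and [r], hence in their common cell, where the derivative
    keeps its sign. *)
Lemma mvt_sg p t r : same_pos p^`() t r ->
  Num.sg (p.[t] - p.[r]) = Num.sg (t - r) * Num.sg p^`().[t].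
Proof.
have [->|ne] := eqVneq t r; first by rewrite !subrr sgr0 mul0r.
wlog tr : t r ne / t < r.
  move=> H h; case: (ltgtP t r) => [/H|rt|/eqP]; [exact| |by rewrite (negPf ne)].
  have h' := same_pos_sym h.
  rewrite -[_ - _]opprB sgrN H // 1?eq_sym // -[t - r]opprB sgrN mulNr.
  by rewrite (same_pos_sg h').
move=> h; have [c] := poly_mvt p tr; rewrite in_itv /= => /andP[tc cr] E.
rewrite -[_ - _]opprB E mulrC -mulNr opprB sgrM; congr (_ * _).
apply: same_pos_sg => s /h /esym E'; apply: esym; apply: (@sgr_between _ _ r) => //.
by rewrite !ltW.
Qed.

Lemma nearest_root q u e : q != 0 ->
  (forall r, root q r -> Num.sg (r - u) != e) \/
  exists r, [/\ root q r, Num.sg (r - u) = e &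
    forall s, root q s -> Num.sg (s - u) = e -> `|r - u| <= `|s - u|].
Proof.
move=> q0; pose rs := [seq r <- rootsR q | Num.sg (r - u) == e].
have rsP r : (r \in rs) = root q r && (Num.sg (r - u) == e).
  by rewrite mem_filter andbC -(roots_on_rootsR q0).
case E: rs => [|r0 rs'].
  by left=> r qr; apply/negP => re; move: (rsP r); rewrite E qr re.
right; have : exists r, r \in rs /\ forall s, s \in rs -> `|r - u| <= `|s - u|.
  rewrite E; elim: rs' r0 {E} => [|r1 rs' IH] r0.
    by exists r0; rewrite mem_head; split=> // s; rewrite inE => /eqP->.
  have [r [rin rmin]] := IH r1.
  case: (lerP `|r0 - u| `|r - u|) => H.
    exists r0; rewrite mem_head; split=> // s; rewrite inE => /orP[/eqP->//|/rmin].
    exact: le_trans.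
  exists r; rewrite inE rin orbT; split=> // s; rewrite inE => /orP[/eqP->|/rmin//].
  exact: ltW.
case=> r [rin rmin]; exists r; move: rin; rewrite rsP => /andP[qr /eqP re].
by split=> // s qs se; apply: rmin; rewrite rsP qs se eqxx.
Qed.

(** Past both Cauchy bounds, [p] and its derivative have the signs of their leading coefficients,
    which agree; the derivative keeps its sign from [u] on. *)
Lemma sg_far_right p u : p^`() != 0 -> (forall s, root p^`() s -> s < u) ->
  exists2 v, u < v & Num.sg p.[v] = Num.sg p^`().[u].
Proof.
move=> p'0 H.
have p0 : p != 0 by apply: contraNneq p'0 => ->; rewrite deriv0.
pose v := Num.max (u+1) (Num.max (cauchy_bound p) (cauchy_bound p^`())).
have uv : u < v by rewrite /v lt_max ltrDl ltr01.
exists v => //.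
have big q : cauchy_bound q <= v -> q != 0 -> Num.sg q.[v] = sgp_pinfty q.
  move=> bv q0; apply: (@sgp_pinftyP _ (cauchy_bound q)); last by rewrite in_itv /= bv.
  exact: ge_cauchy_bound.
rewrite big // ?le_max ?lexx ?orbT //.
have -> : Num.sg p^`().[u] = Num.sg p^`().[v].
  apply: (@polyrN0_itv _ `[u, v]); rewrite ?in_itv /= ?lexx ?ltW //.
  move=> s; rewrite in_itv /= => /andP[us _]; apply/negP => /H; rewrite ltNge us //.
rewrite big // ?le_max ?lexx ?orbT // /sgp_pinfty.
have sp : (1 < size p)%N.
  by rewrite ltnNge; apply: contra p'0 => /size1_polyC ->; rewrite derivC.
rewrite !lead_coefE size_deriv coef_deriv.
case: (size p) sp => [|[|k]] //= _.
by rewrite -mulr_natr sgrM [Num.sg _%:R]gtr0_sg ?ltr0n // mulr1.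
Qed.

Lemma sg_far p u e : p^`() != 0 -> (forall s, root p^`() s -> Num.sg (s - u) != e) ->
  ~~ root p^`() u -> e = 1 \/ e = -1 ->
  exists v, Num.sg (v - u) = e /\ Num.sg p.[v] = e * Num.sg p^`().[u].
Proof.
move=> p'0 H nu [] ee; subst e.
  have [|v uv Ev] := @sg_far_right p u p'0.
    move=> s rs; move: (H s rs); rewrite sgr_cp0 subr_gt0 -leNgt le_eqVlt => /orP[/eqP E|//].
    by rewrite -E rs in nu.
  by exists v; rewrite mul1r Ev gtr0_sg ?subr_gt0.
(* The left side reduces to the right side by reflecting the line. *)
pose P := p \Po -'X.
have dP : P^`() = - (p^`() \Po -'X) by rewrite deriv_comp derivN derivX mulrN1.
have rP s : root P^`() s = root p^`() (- s).
  by rewrite dP /root hornerN oppr_eq0 horner_comp hornerN hornerX.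
have [||v uv Ev] := @sg_far_right P (- u).
- by rewrite dP oppr_eq0 comp_poly2_eq0 // size_polyN size_polyX.
- move=> s; rewrite rP => rs; move: (H _ rs).
  rewrite sgr_cp0 subr_lt0 -leNgt le_eqVlt => /orP[/eqP E|]; last by lra.
  by rewrite E rs in nu.
exists (- v); move: Ev; rewrite dP /P hornerN !horner_comp !hornerN !hornerX opprK sgrN => ->.
by rewrite mulN1r ltr0_sg // subr_lt0; lra.
Qed.

(** The intermediate value theorem is applied at a level [y] of sign [a] strictly between the two
    values: [p.[v] / 2], or [0] when [a = 0]. Strictness keeps [w] away from [v]. *)
Lemma ivt_sg p u v a : Num.sg p.[v] != 0 -> a != Num.sg p.[u] ->
  a = Num.sg p.[v] \/ (a = 0 /\ Num.sg p.[v] = - Num.sg p.[u]) ->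
  exists w, (u < w < v \/ v < w < u) /\ Num.sg p.[w] = a.
Proof.
move=> v0 au H.
have [y [ya yb]] : exists y, Num.sg y = a /\ (p.[u] - y) * (p.[v] - y) < 0.
  case: H => [E|[-> E]].
    exists (p.[v] / 2); split.
      by rewrite sgrM [Num.sg 2^-1]gtr0_sg ?mulr1 // invr_gt0 ltr0n.
    rewrite {}E in au; move: v0 au.
    case: (sgrP p.[v]); case: (sgrP p.[u]); rewrite ?eqxx // => *; nra.
  exists 0; rewrite sgr0 !subr0; split=> //.
  move: E v0; case: (sgrP p.[v]); case: (sgrP p.[u]); rewrite ?eqxx ?opprK ?oppr0 //; 
    do ?[by move=> *; nra | by lra].
have ivt (b c : N) : b <= c -> (p.[b] - y) * (p.[c] - y) < 0 ->
    exists w, b < w < c /\ Num.sg p.[w] = a.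
  move=> bc h; have [|w] := @poly_ivtoo _ (p - y%:P) _ _ bc.
    by rewrite !hornerE.
  rewrite in_itv /= => bwc; rewrite /root !hornerE subr_eq0 => /eqP E.
  by exists w; rewrite E.
case: (lerP u v) => [uv|/ltW vu].
  by have [w [h1 h2]] := ivt _ _ uv yb; exists w; split=> //; left.
rewrite mulrC in yb; have [w [h1 h2]] := ivt _ _ vu yb.
by exists w; split=> //; right.
Qed.

End OneRcf.

(** * Sign diagrams over two real closed fields *)

Section Step.
Variables (N1 N2 : rcfType) (rho : N1 -> N2 -> Prop).
Variables (G p : {poly N1}) (G' p' : {poly N2}).

(* [rho t t'] says that [t] and [t'] occupy matching cells of the two lines cut
   at the roots of [G] and [G']. *)
Record cell_data : Prop := CellData {
  cell_totl : forall t, exists t', rho t t';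
  cell_totr : forall t', exists t, rho t t';
  cell_root : forall t t', rho t t' -> root G t = root G' t';
  cell_pos : forall r r' t t', root G r -> rho r r' -> rho t t' ->
    sgz (t - r) = sgz (t' - r') }.

Record deriv_data : Prop := DerivData {
  der_cell :> cell_data;
  der_neq0 : G != 0;
  der_neq0' : G' != 0;
  der_root : forall s, root p^`() s -> root G s;
  der_root' : forall s, root p'^`() s -> root G' s;
  der_sg : forall t t', rho t t' -> sgz p^`().[t] = sgz p'^`().[t'];
  der_at : forall r r', root G r -> rho r r' -> sgz p.[r] = sgz p'.[r'] }.

(* The matching for the finer cell decomposition that also cuts at the roots of
   [p] and [p']: as [p] is monotone on each old cell, its sign locates a point
   inside the cell. *)
Definition refined t t' := sgz p.[t] = sgz p'.[t'] /\
  forall r r', root G r -> rho r r' -> sgz (t - r) = sgz (t' - r').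
End Step.

Lemma cell_flip N1 N2 rho G G' : @cell_data N1 N2 rho G G' ->
  cell_data (fun t' t => rho t t') G' G.
Proof.
case=> h1 h2 h3 h4; split=> // [t' t|r' r t' t] h; first by rewrite (h3 _ _ h).
by move=> rr tt; apply/esym/h4 => //; rewrite (h3 _ _ rr).
Qed.

Lemma deriv_flip N1 N2 rho G p G' p' : @deriv_data N1 N2 rho G p G' p' ->
  deriv_data (fun t' t => rho t t') G' p' G p.
Proof.
case=> hc h1 h2 h3 h4 h5 h6; split=> //; first exact: cell_flip.
  by move=> t' t /h5.
by move=> r' r rr h; rewrite (h6 r r') // (cell_root hc h).
Qed.

Lemma refined_flip N1 N2 rho G p G' p' : @cell_data N1 N2 rho G G' -> forall t t',
  @refined N1 N2 rho G p p' t t' -> refined (fun t' t => rho t t') G' p' p t' t.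
Proof.
move=> hc t t' [h1 h2]; split=> // r' r rr h; rewrite (h2 r r') //.
by rewrite (cell_root hc h).
Qed.

(** Start from a [rho]-match [u] of [t]. If [p'] has the wrong sign there, its monotonicity tells in
    which direction to move inside the cell of [u], and the intermediate value theorem finds the
    right sign before the end of the cell. *)
Lemma refined_total N1 N2 rho G p G' p' : @deriv_data N1 N2 rho G p G' p' ->
  forall t, exists t', refined rho G p p' t t'.
Proof.
move=> H t; have [u tu] := cell_totl H t.
have pos_u r r' : root G r -> rho r r' -> sgz (t - r) = sgz (u - r').
  by move=> Gr rr; apply: (cell_pos H).
have [Gt|nGt] := boolP (root G t).
  by exists u; split=> //; exact: (der_at H).
have nGu : ~~ root G' u by rewrite -(cell_root H tu).
have [E|NE] := eqVneq (sgz p.[t]) (sgz p'.[u]); first by exists u.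
(* [d] is the direction in which the sign of [p'] must change; [e] below is the side of [u] on which
   [p'] moves that way. *)
pose d : int := sgz (sgz p.[t] - sgz p'.[u]).
have dt0 : sgz p^`().[t] != 0.
  by rewrite sgz_eq0; apply: contra nGt => h; apply: (der_root H).
have dcase : d = 1 \/ d = -1.
  by move: NE; rewrite -subr_eq0 -sgz_eq0 -/d; rewrite /d; case: (sgzP (_ - _)) => //; auto.
have tcase : sgz p.[t] = d \/ sgz p.[t] = 0 /\ d = - sgz p'.[u].
  by move: NE; rewrite /d; case: (sgzP p.[t]); case: (sgzP p'.[u]); auto.
clearbody d.
pose e : int := d * sgz p^`().[t].
have ecase : e = 1 \/ e = -1.
  by move: dt0; rewrite /e; case: dcase => ->; case: sgzP => // _ _; auto.
have ede : e * sgz p^`().[t] = d.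
  by move: dt0; rewrite /e; case: sgzP => // _ _; ring.
clearbody e.
(* No root of [G'] on side [e] is nearer to [u] than [v], so a point strictly between [u] and [v]
   stays in the cell of [u]. *)
suff [v [v_side vfree vsg]] : exists v, [/\ sgz (v - u) = e,
    forall s, root G' s -> sgz (s - u) = e -> `|v - u| <= `|s - u| & sgz p'.[v] = d].
  have [|||w [wuv wsg]] := @ivt_sg _ p' u v (sgz p.[t])%:~R.
  - by rewrite sgr_eq0 -sgz_eq0 vsg; case: dcase => ->.
  - by rewrite sgrEz eqr_int.
  - rewrite !sgrEz vsg; case: tcase => [->|[-> ->]].
    + by left.
    + by right; rewrite mulrNz.
  exists w; split.
    by apply/esym; move: wsg; rewrite sgrEz => /intr_inj.
  move=> r r' Gr rr; rewrite (pos_u r r') //.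
  have Gr' : root G' r' by rewrite -(cell_root H rr).
  have ru : r' != u by apply: contraNneq nGu => <-.
  have := vfree r' Gr'; move: v_side.
  rewrite -subr_eq0 in ru.
  case: ecase => -> /eqP; rewrite sgz_cp0 => vs.
    case: (sgzP (r' - u)) => [/eqP|hr|hr]; first by rewrite (negPf ru).
      move/(_ erefl); rewrite !gtr0_norm // => le.
      by rewrite !ltr0_sgz //; case: wuv => /andP[]; lra.
    by move=> _; rewrite !gtr0_sgz //; case: wuv => /andP[]; lra.
  case: (sgzP (r' - u)) => [/eqP|hr|hr]; first by rewrite (negPf ru).
    by move=> _; rewrite !ltr0_sgz //; case: wuv => /andP[]; lra.
  move/(_ erefl); rewrite !ltr0_norm // => le.
  by rewrite !gtr0_sgz //; case: wuv => /andP[]; lra.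
have dE := der_sg H tu.
(* Either the cell is unbounded on side [e], or it ends at a root [r'], where the sign of [p'] is
   read off from the matching root [r] of [G]. *)
case: (@nearest_root _ G' u e%:~R (der_neq0' H)) => [none|[r' [Gr' rs rmin]]].
  have [||||v [vs ve]] := @sg_far _ p' u e%:~R.
  - by apply: contraNneq dt0 => p'0; rewrite dE p'0 horner0 sgz0.
  - by move=> s /(der_root' H) /none.
  - by apply: contra nGu; apply: (der_root' H).
  - by case: ecase => ->; auto.
  exists v; split.
  - by move: vs; rewrite sgrEz => /intr_inj.
  - by move=> s /none; rewrite sgrEz eqr_int => /eqP.
  - by move: ve; rewrite !sgrEz -intrM => /intr_inj ->; rewrite -dE.
exists r'; split.
- by move: rs; rewrite sgrEz => /intr_inj.
- by move=> s Gs E; apply: rmin => //; rewrite sgrEz E.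
have [r rr] := cell_totr H r'.
have Gr : root G r by rewrite (cell_root H rr).
rewrite -(der_at H Gr rr).
have sr : sgz (r - t) = e.
  by rewrite -opprB sgzN (pos_u r r') // -sgzN opprB; move: rs; rewrite sgrEz => /intr_inj.
(* A root of [G] strictly between [r] and [t] would match a root of [G'] nearer to [u] than [r']. *)
have sep s : root G s -> ~ (r < s < t \/ t < s < r).
  move=> Gs hs; have [s' ss] := cell_totl H s.
  have Gs' : root G' s' by rewrite -(cell_root H ss).
  have h1 := pos_u _ _ Gs ss.
  have h2 := cell_pos H Gs ss rr.
  have h3 := pos_u _ _ Gr rr.
  have sus : sgz (s' - u) = e.
    rewrite -sr -[s' - u]opprB -[r - t]opprB !sgzN -h1; congr (- _).
    by case: hs => /andP[a b]; [rewrite !gtr0_sgz | rewrite !ltr0_sgz]; rewrite ?subr_gt0 ?subr_lt0 ?(lt_trans a b).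
  have := rmin s' Gs'; rewrite sgrEz sus => /(_ erefl).
  case: hs => /andP[a b].
    rewrite !ltr0_norm; try (rewrite -sgz_cp0; apply/eqP); rewrite -?sgz_cp0.
    + move: h2; rewrite ltr0_sgz ?subr_lt0 // => /esym/eqP; rewrite sgz_cp0; lra.
    + by rewrite sus -sr ltr0_sgz ?subr_lt0 // (lt_trans a b).
    + by move: rs; rewrite sgrEz => /intr_inj ->; rewrite -sr ltr0_sgz ?subr_lt0 // (lt_trans a b).
  rewrite !gtr0_norm; try (rewrite -sgz_cp0; apply/eqP); rewrite -?sgz_cp0.
  + move: h2; rewrite gtr0_sgz ?subr_gt0 // => /esym/eqP; rewrite sgz_cp0; lra.
  + by rewrite sus -sr gtr0_sgz ?subr_gt0 // (lt_trans a b).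
  + by move: rs; rewrite sgrEz => /intr_inj ->; rewrite -sr gtr0_sgz ?subr_gt0 // (lt_trans a b).
(* By the mean value theorem [p] moves in direction [d] from [t] to [r]; as [p.[t]] has sign [d] or
   zero, [p.[r]] has sign [d]. *)
have key : sgz (p.[r] - p.[t]) = d.
  rewrite -ede -sr.
  have sgc c : r < c < t \/ t < c < r -> sgz p^`().[c] = sgz p^`().[t].
    move=> hc; suff E : Num.sg p^`().[c] = Num.sg p^`().[t].
      by move: E; rewrite !sgrEz => /intr_inj.
    apply: same_pos_sg => s /(der_root H) Gs; have := sep s Gs.
    have ts : t != s by apply: contraNneq nGt => ->.
    case: hc => /andP[a b] hs; case: (ltgtP t s) ts => // ts _.
    - by rewrite !ltr0_sg ?subr_lt0 // (lt_trans b).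
    - have rs' : s <= r by rewrite leNgt; apply/negP => ?; apply: hs; left; apply/andP.
      by rewrite !gtr0_sg ?subr_gt0 // (le_lt_trans rs').
    - have rs' : r <= s by rewrite leNgt; apply/negP => ?; apply: hs; right; apply/andP.
      by rewrite !ltr0_sg ?subr_lt0 // (lt_le_trans b).
    - by rewrite !gtr0_sg ?subr_gt0 // (lt_trans ts).
  have rt : r != t by apply: contraNneq nGt => <-.
  case: (ltgtP r t) rt => // rt _.
    have [c] := poly_mvt p rt; rewrite in_itv /= => hc E.
    rewrite -[p.[r] - _]opprB E sgzN sgzM -mulrN -sgzN opprB (sgc c); last by left.
    by rewrite mulrC.
  have [c] := poly_mvt p rt; rewrite in_itv /= => hc E.
  by rewrite E sgzM (sgc c) 1?mulrC; last by right.
have {}tcase : sgz p.[t] = d \/ sgz p.[t] = 0 by case: tcase => [|[]]; auto.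
case: dcase key tcase => -> /eqP; rewrite sgz_cp0 => key [] /eqP;
  rewrite ?sgz_eq0 ?sgz_cp0 => h.
- by rewrite gtr0_sgz // (lt_trans h) // -subr_gt0.
- by move: key; rewrite (eqP h) subr0 => key; rewrite gtr0_sgz.
- by rewrite ltr0_sgz // (lt_trans _ h) // -subr_lt0.
- by move: key; rewrite (eqP h) subr0 => key; rewrite ltr0_sgz.
Qed.

(** If a root of [G] separates [t] from a root [r] of [p], it fixes their order on both lines.
    Otherwise both lie in one cell and [mvt_sg] writes the sign of [p.[t]] as that of [t - r] times
    the nonzero sign of the derivative, so equal signs of [p] and [p'] force equal orders. *)
Lemma refined_pos N1 N2 rho G p G' p' : @deriv_data N1 N2 rho G p G' p' ->
  p^`() != 0 ->
  forall r r' t t', root G r \/ root p r -> refined rho G p p' r r' ->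
    refined rho G p p' t t' -> sgz (t - r) = sgz (t' - r').
Proof.
move=> H p'0 r r' t t'.
have refG s s' : root G s -> refined rho G p p' s s' -> rho s s'.
  move=> Gs [_ h]; have [s0 ss0] := cell_totl H s.
  have := h s s0 Gs ss0; rewrite subrr sgz0 => /esym/eqP.
  by rewrite sgz_eq0 subr_eq0 => /eqP->.
have [Gr _ rr [_ ht]|nGr] := boolP (root G r); first by apply: ht => //; apply: refG.
case=> // pr [rr1 rr2] [tt1 tt2].
have pr' : root p' r' by rewrite /root -sgz_eq0 -rr1 sgz_eq0.
have sgB (N : rcfType) (x y s : N) :
    sgz (x - s) != sgz (y - s) -> sgz (x - y) = sgz (sgz (x - s) - sgz (y - s)).
  case: (sgzP (x - s)); case: (sgzP (y - s)) => //= h1 h2 _;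
    by [rewrite gtr0_sgz //; lra | rewrite ltr0_sgz //; lra].
pose apart := exists s, root G s /\ sgz (t - s) != sgz (r - s).
have [[s [Gs ns]]|same] := boolp.EM apart.
  have [s' ss] := cell_totl H s.
  rewrite (sgB _ _ _ s) // (sgB _ _ _ s') -?(tt2 s s') -?(rr2 s s') //.
have {}same s : root G s -> sgz (t - s) = sgz (r - s).
  by move=> Gs; apply/eqP/negP => ns; apply: same; exists s; split=> //; apply/negP.
have tu : exists u, rho t u by apply: (cell_totl H).
case: tu => u tu.
have sgu s' : root G' s' -> sgz (t' - s') = sgz (r' - s') /\ sgz (u - s') = sgz (t' - s').
  move=> Gs'; have [s ss] := cell_totr H s'.
  have Gs : root G s by rewrite (cell_root H ss).
  by rewrite -(tt2 s) // -(rr2 s) // same // -(cell_pos H Gs ss tu) same.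
have sgzsg (N : rcfType) (x y : N) : sgz x = sgz y -> Num.sg x = Num.sg y.
  by rewrite !sgrEz => ->.
have e1 : sgz p.[t] = sgz (t - r) * sgz p^`().[t].
  have := @mvt_sg _ p t r; rewrite (rootP pr) subr0 !sgrEz -intrM => h.
  by apply/(@intr_inj N1)/h => s /(der_root H) Gs; apply: sgzsg; apply: same.
have e2 : sgz p'.[t'] = sgz (t' - r') * sgz p'^`().[t'].
  have := @mvt_sg _ p' t' r'; rewrite (rootP pr') subr0 !sgrEz -intrM => h.
  by apply/(@intr_inj N2)/h => s /(der_root' H) Gs; apply: sgzsg; case: (sgu s Gs).
have e3 : sgz p^`().[t] = sgz p'^`().[t'].
  rewrite (der_sg H tu); suff : Num.sg p'^`().[u] = Num.sg p'^`().[t'].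
    by rewrite !sgrEz => /intr_inj.
  by apply: same_pos_sg => s /(der_root' H) Gs; apply: sgzsg; case: (sgu s Gs).
have nz : sgz p^`().[t] != 0.
  rewrite sgz_eq0; apply: contra nGr => h; have Gt := der_root H h.
  have := same t Gt; rewrite subrr sgz0 => /esym/eqP.
  by rewrite sgz_eq0 subr_eq0 => /eqP->.
by move: tt1; rewrite e1 e2 -e3 => /(mulIf nz).
Qed.

(** A [rho]-match of [t] lies in the cell of [t'], where [q'] has constant sign. *)
Lemma refined_sg N1 N2 rho G p G' p' q q' : @deriv_data N1 N2 rho G p G' p' ->
  (forall s, root q' s -> root G' s) ->
  (forall t t', rho t t' -> sgz q.[t] = sgz q'.[t']) ->
  forall t t', refined rho G p p' t t' -> sgz q.[t] = sgz q'.[t'].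
Proof.
move=> H qG qE t t' [_ tt]; have [u tu] := cell_totl H t.
rewrite (qE _ _ tu); suff : Num.sg q'.[u] = Num.sg q'.[t'].
  by rewrite !sgrEz => /intr_inj.
apply: same_pos_sg => s' /qG Gs'; have [s ss] := cell_totr H s'.
have Gs : root G s by rewrite (cell_root H ss).
by rewrite !sgrEz -(tt s s') // -(cell_pos H Gs ss tu).
Qed.

(** * Families of polynomials with the same sign diagram *)

Section Sim.
Variables (N1 N2 : rcfType).
Implicit Type L : seq ({poly N1} * {poly N2}).

(* The families [L] of polynomial pairs have the same sign diagram. *)
Definition sim L := exists rho : N1 -> N2 -> Prop,
  [/\ forall t, exists t', rho t t', forall t', exists t, rho t t',
   forall t t' pq, rho t t' -> pq \in L -> sgz pq.1.[t] = sgz pq.2.[t'] &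
   forall pq r r' t t', pq \in L -> pq.1 != 0 -> root pq.1 r ->
     rho r r' -> rho t t' -> sgz (t - r) = sgz (t' - r')].

Lemma sim_sub L L' : {subset L' <= L} -> sim L -> sim L'.
Proof.
move=> sL [rho [h1 h2 h3 h4]]; exists rho; split=> //.
  by move=> t t' pq tt /sL; apply: h3.
by move=> pq r r' t t' /sL; apply: h4.
Qed.

Lemma sim_const L c c' : sgz c = sgz c' -> sim L -> sim ((c%:P, c'%:P) :: L).
Proof.
move=> E [rho [h1 h2 h3 h4]]; exists rho; split=> //.
  move=> t t' pq tt; rewrite inE => /orP[/eqP->|]; last exact: h3.
  by rewrite /= !hornerC.
move=> pq r r' t t'; rewrite inE => /orP[/eqP->|]; last exact: h4.
by rewrite /= polyC_eq0 rootC => /negPf->.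
Qed.

Lemma sim_nil : sim [::].
Proof. by exists (fun _ _ => True); split=> // t; exists 0. Qed.

Lemma sgz_poly_eq0 (N : rcfType) (p : {poly N}) : (forall t, sgz p.[t] = 0) -> p = 0.
Proof.
move=> h; apply/eqP; apply/negPn/negP => p0.
have := ge_cauchy_bound p0; move/(_ (cauchy_bound p)); rewrite in_itv /= lexx => /(_ isT).
by rewrite /root -sgz_eq0 h.
Qed.

(** This product cuts the line at the roots of the whole family; zero members are left out, since
    they would make every point a root. *)
Lemma prod_root (N : rcfType) (s : seq {poly N}) :
  let G := \prod_(p <- s | p != 0) p in
  G != 0 /\ forall r, root G r = has (fun p => (p != 0) && root p r) s.
Proof.
elim: s => [|p s /= [IH1 IH2]] /=.
  by rewrite big_nil oner_eq0; split=> // r; rewrite (negPf (root1 r)).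
rewrite big_cons; case: (eqVneq p 0) => [->|p0] /=; first by [].
by split=> [|r]; rewrite ?mulf_neq0 // rootM IH2.
Qed.

(* Hormander's step: the diagram of a family containing [p'] extends to [p] once
   the sign of [p] is known at the roots of the family. *)
Lemma sim_deriv L L0 p p' : sim L -> {subset L0 <= L} ->
  p^`() != 0 -> (p^`(), p'^`()) \in L0 ->
  (forall t t', (forall pq, pq \in L -> sgz pq.1.[t] = sgz pq.2.[t']) ->
     forall pq, pq \in L0 -> pq.1 != 0 -> pq.2 != 0 -> root pq.1 t -> root pq.2 t' ->
     sgz p.[t] = sgz p'.[t']) ->
  sim ((p, p') :: L0).
Proof.
move=> [rho [h1 h2 h3 h4]] sL p'0 pL hp.
(* A polynomial is zero exactly when all its values have sign zero, a property that [rho] carries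
   across. *)
have eq0 pq : pq \in L0 -> (pq.1 != 0) = (pq.2 != 0).
  move=> /sL pqL; congr negb; apply/eqP/eqP => e; apply: sgz_poly_eq0 => t.
    by have [t' tt] := h2 t; rewrite -(h3 _ _ _ tt pqL) e horner0 sgz0.
  by have [t' tt] := h1 t; rewrite (h3 _ _ _ tt pqL) e horner0 sgz0.
have rt t t' pq : rho t t' -> pq \in L0 -> root pq.1 t = root pq.2 t'.
  by move=> tt /sL pqL; rewrite /root -sgz_eq0 (h3 _ _ _ tt pqL) sgz_eq0.
have := prod_root [seq pq.1 | pq <- L0]; have := prod_root [seq pq.2 | pq <- L0].
set G' := \prod_(i <- _ | _) _; set G := \prod_(i <- _ | _) _ => /= -[G'0 rG'] [G0 rG].
have rGP r : root G r -> exists pq, [/\ pq \in L0, pq.1 != 0 & root pq.1 r].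
  by rewrite rG => /hasP[_ /mapP[pq pqL ->] /andP[]]; exists pq.
have rGE pq r : pq \in L0 -> pq.1 != 0 -> root pq.1 r -> root G r.
  by move=> pqL h h'; rewrite rG; apply/hasP; exists pq.1; rewrite ?map_f ?h.
have rGE' pq r : pq \in L0 -> pq.1 != 0 -> root pq.2 r -> root G' r.
  by move=> pqL h h'; rewrite rG'; apply/hasP; exists pq.2; rewrite ?map_f -?eq0 ?h.
have cd : cell_data rho G G'.
  split=> // [t t' tt|r r' t t' /rGP[pq [pqL pq0 rr]]]; last by apply: (h4 pq) => //; apply: sL.
  rewrite rG rG' !has_map; apply: eq_in_has => pq pqL /=.
  by rewrite eq0 // (rt _ _ _ tt).
have dd : deriv_data rho G p G' p'.
  split=> //.
  - by move=> s; apply: rGE pL p'0.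
  - by move=> s; apply: rGE' pL p'0.
  - by move=> t t' tt; apply: (h3 _ _ _ tt (sL _ pL)).
  - move=> r r' /rGP[pq [pqL pq0 rr]] rho_r; apply: (hp r r' _ pq) => //.
    + by move=> pq' pqL'; apply: h3.
    + by rewrite -eq0.
    + by rewrite -(rt _ _ _ rho_r).
exists (refined rho G p p'); split.
- exact: refined_total dd.
- move=> t'; have [t tt] := refined_total (deriv_flip dd) t'; exists t.
  exact: (refined_flip (cell_flip cd)).
- move=> t t' pq tt; rewrite inE => /orP[/eqP->|pqL]; first by case: tt.
  have [pq0|] := boolP (pq.1 != 0); last first.
    by move=> h; move: (h); rewrite eq0 //; move: h; rewrite !negbK => /eqP-> /eqP->; rewrite !horner0 !sgz0.
  apply: (refined_sg dd) tt; first by move=> s; apply: rGE'.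
  by move=> u u' uu; apply: h3 uu (sL _ pqL).
- move=> pq r r' t t'; rewrite inE => /orP[/eqP->|pqL] /= pq0 pr rr tt.
    by apply: (refined_pos dd) rr tt => //; right.
  by apply: (refined_pos dd) rr tt => //; left; apply: rGE pqL pq0 pr.
Qed.
End Sim.
(** * Uniform sign transfer *)

Import Pdiv.Ring Pdiv.ComRing.

Section Images.
Variables (N1 N2 : rcfType) (D : comNzRingType).
Implicit Types (P : seq {poly D}) (p q : {poly D}).

(* At a root of [p'] this has the sign of [p], but its degree is smaller. *)
Definition degree_defect p : {poly D} := (size p).-1%:R *: p - 'X * p^`().

(** The coefficient of degree [j] is [(size p).-1 - j] times that of [p], so the leading one
    cancels. *)
Lemma size_degree_defect p d : (size p <= d.+1)%N -> (size (degree_defect p) <= d)%N.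
Proof.
move=> sp; apply/leq_sizeP => j dj; rewrite coefB coefZ coefXM coef_deriv.
suff H : p`_j = 0 \/ j = (size p).-1.
  case: j dj H => [|j] dj /= [->|e]; rewrite ?mulr0 ?mul0rn ?subr0 //.
    by rewrite -e mul0r.
  by rewrite -e mulr_natl subrr.
case: (leqP (size p) j) => [/(nth_default 0)|jp]; first by left.
right; apply/eqP; rewrite eqn_leq -ltnS (ltn_predK jp) jp /=.
by rewrite -ltnS (ltn_predK jp) (leq_trans sp).
Qed.

Variables (phi1 : {rmorphism D -> N1}) (phi2 : {rmorphism D -> N2}).
Definition images P := [seq (map_poly phi1 p, map_poly phi2 p) | p <- P].

Definition same_signs (c : D) := sgz (phi1 c) = sgz (phi2 c).

(* An evaluation of the coefficients may kill the leading ones, so [q] is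
   replaced by all the polynomials it may degenerate to. *)
Definition truncations q := [seq r <- [seq take_poly j q | j <- iota 0 (size q).+1] | r != 0].
Definition pseudo_rems p P := flatten [seq [seq rmodp p r | r <- truncations q] | q <- P].
Definition descent p P := p^`() :: degree_defect p :: P ++ pseudo_rems p P.

(** At a root of [q] the pseudo-division identity loses its quotient term. *)
Lemma rem_sg (N : rcfType) (phi : {rmorphism D -> N}) p q t :
  root (map_poly phi q) t ->
  sgz (phi (lead_coef q)) ^+ rscalp p q * sgz (map_poly phi p).[t] =
  sgz (map_poly phi (rmodp p q)).[t].
Proof.
move=> /rootP qt; have := congr1 (fun r => (map_poly phi r).[t]) (rdivp_eq q p).
rewrite rmorphD rmorphM hornerD hornerM /= qt mulr0 add0r => <-.
by rewrite map_polyZ hornerZ sgzM rmorphXn sgzX.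
Qed.

Lemma degree_defect_sg (N : rcfType) (phi : {rmorphism D -> N}) p t :
  (1 < size p)%N -> root (map_poly phi p^`()) t ->
  sgz (map_poly phi (degree_defect p)).[t] = sgz (map_poly phi p).[t].
Proof.
move=> sp /rootP pt; rewrite rmorphB rmorphM /= map_polyZ map_polyX.
rewrite hornerD hornerN hornerM pt mulr0 subr0 hornerZ sgzM rmorph_nat.
by rewrite gtr0_sgz ?mul1r // ltr0n; case: (size p) sp => [|[]].
Qed.

Lemma map_take_poly (N : rcfType) (phi : {rmorphism D -> N}) q n :
  (forall i, (n <= i)%N -> phi q`_i = 0) -> map_poly phi (take_poly n q) = map_poly phi q.
Proof.
move=> h; apply/polyP => i; rewrite !coef_map /= coef_take_poly.
by case: ltnP => // /h ->; rewrite rmorph0.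
Qed.

(** [sim_deriv] applies once the sign of [p] is known at the roots of the other polynomials:
    [degree_defect p] gives it at the roots of the derivative, the pseudo-remainders at the roots of
    [P]. If the image of [p] is constant, the signs of the coefficients suffice. *)
Lemma sim_descent p P : {in p :: P, forall q i, same_signs q`_i} ->
  sim (images (descent p P)) -> sim (images (p :: P)).
Proof.
move=> E S; have E0 q i : q \in p :: P -> (phi1 q`_i == 0) = (phi2 q`_i == 0).
  by move=> qP; rewrite -sgz_eq0 (E q qP i) sgz_eq0.
have [c0|nc] := eqVneq (map_poly phi1 p)^`() 0.
  have s1 : (size (map_poly phi1 p) <= 1)%N.
    by rewrite -subn_eq0 subn1 -size_deriv c0 size_poly0.
  have s2 : (size (map_poly phi2 p) <= 1)%N.
    apply/leq_sizeP => j j1; apply/eqP; rewrite coef_map -E0 ?mem_head //=.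
    by rewrite -coef_map nth_default // (leq_trans s1).
  rewrite /images /= (size1_polyC s1) (size1_polyC s2); apply: sim_const.
    by rewrite !coef_map; apply: E; rewrite mem_head.
  by apply: sim_sub S => _ /mapP[q qP ->]; apply: map_f; rewrite !inE mem_cat qP !orbT.
have p'E (N : rcfType) (phi : {rmorphism D -> N}) : (map_poly phi p)^`() = map_poly phi p^`().
  by rewrite deriv_map.
have sp : (1 < size p)%N.
  rewrite ltnNge; apply: contra nc => /size1_polyC ->.
  by rewrite map_polyC derivC.
apply: (@sim_sub _ _ ((map_poly phi1 p, map_poly phi2 p) :: images (p^`() :: P))).
  by move=> x; rewrite !inE => /orP[->//|->]; rewrite !orbT.
apply: (@sim_deriv _ _ (images (descent p P)) (images (p^`() :: P))) => //.
- move=> _ /mapP[q qP ->]; apply: map_f; move: qP; rewrite !inE mem_cat.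
  by case/orP => ->; rewrite ?orbT.
- by rewrite !p'E mem_head.
move=> t t' hL _ /mapP[q qP ->] /= q1 q2 r1 r2.
move: qP; rewrite inE => /orP[/eqP E1|qP].
  rewrite {}E1 in q1 q2 r1 r2.
  have := hL _ (map_f _ (_ : degree_defect p \in descent p P)).
  by rewrite !inE eqxx orbT /= !degree_defect_sg // => ->.
(* [n] is the size of [q] after evaluation, so the truncation [r] has the same images as [q] and its
   leading coefficient survives both evaluations. *)
pose n := size (map_poly phi1 q); pose r := take_poly n q.
have n0 : (0 < n)%N by rewrite size_poly_gt0.
have qP' : q \in p :: P by rewrite inE qP orbT.
have h1 i : (n <= i)%N -> phi1 q`_i = 0.
  by move=> ni; rewrite -coef_map nth_default.
have h2 i : (n <= i)%N -> phi2 q`_i = 0.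
  by move=> /h1 /eqP; rewrite E0 // => /eqP.
have qn : phi1 q`_n.-1 != 0 by rewrite -coef_map -lead_coefE lead_coef_eq0.
have qn0 : q`_n.-1 != 0 by apply: contraNneq qn => ->; rewrite rmorph0.
have rn : r`_n.-1 = q`_n.-1 by rewrite coef_take_poly prednK // leqnn.
have sr : size r = n.
  apply/eqP; rewrite eqn_leq size_take_poly /= -(prednK n0) ltnNge.
  by apply: contra qn0 => /leq_sizeP h; rewrite -rn h.
have lr : lead_coef r = q`_n.-1 by rewrite lead_coefE sr rn.
have nq : (n <= size q)%N.
  by rewrite -(prednK n0) ltnNge; apply: contra qn0 => /leq_sizeP h; rewrite h.
have rin : rmodp p r \in descent p P.
  rewrite !inE mem_cat; apply/or4P; apply: Or44; apply/flattenP.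
  exists [seq rmodp p r | r <- truncations q]; first exact: map_f.
  apply: map_f; rewrite mem_filter -size_poly_gt0 sr n0 andTb.
  apply: (map_f (fun j => take_poly j q)).
  by rewrite mem_iota /= add0n ltnS.
have := hL _ (map_f _ rin).
rewrite /= -!rem_sg; [|by rewrite map_take_poly..].
(* The cancelled factor is a power of the sign of the leading coefficient, equal and nonzero on both
   sides. *)
rewrite lr E // => /mulfI; apply; rewrite expf_neq0 // sgz_eq0 -E0 //.
Qed.
End Images.

Section Uniform.
Variables (N1 N2 : rcfType) (D : comNzRingType).
Implicit Types (P : seq {poly D}) (p q : {poly D}).

(* [Q] is chosen before the evaluations: this is quantifier elimination for one
   variable in semantic form. *)
Definition uniform P := exists Q : seq D,
  forall (phi1 : {rmorphism D -> N1}) (phi2 : {rmorphism D -> N2}),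
    {in Q, forall c, same_signs phi1 phi2 c} -> sim (images phi1 phi2 P).

(** All coefficients of [p :: P] join [Q], because [sim_descent] compares their signs. *)
Lemma uniform_descent p P : uniform (descent p P) -> uniform (p :: P).
Proof.
case=> Q hQ; exists (Q ++ flatten [seq polyseq q | q <- p :: P]) => phi1 phi2 h.
apply: sim_descent; last by apply: hQ => c cQ; apply: h; rewrite mem_cat cQ.
move=> q qP i; have [iq|qi] := ltnP i (size q).
  apply: h; rewrite mem_cat; apply/orP; right; apply/flattenP.
  by exists (polyseq q); [exact: map_f | exact: mem_nth].
by rewrite nth_default // /same_signs !rmorph0 !sgz0.
Qed.

Lemma uniform_sub P P' : {subset P' <= P} -> uniform P -> uniform P'.
Proof.
move=> sP [Q hQ]; exists Q => phi1 phi2 /hQ; apply: sim_sub => _ /mapP[q /sP qP ->].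
exact: map_f.
Qed.

Lemma uniform_all P : uniform P.
Proof.
have [d hd] : exists d, {in P, forall p, (size p <= d)%N}.
  exists (\max_(p <- P) size p) => p pP.
  by rewrite (big_rem _ pP) /= leq_maxl.
elim: d P hd => [|d IH] P hd.
  elim: P hd => [|p P IHP] hd.
    by exists [::] => phi1 phi2 _; apply: sim_nil.
  have [|Q hQ] := IHP; first by move=> q qP; apply: hd; rewrite inE qP orbT.
  exists Q => phi1 phi2 /hQ; rewrite /images /=.
  have := hd p (mem_head _ _); rewrite leqn0 size_poly_eq0 => /eqP->.
  by rewrite !map_poly0 -polyC0; apply: sim_const; rewrite !sgz0.
(* [B] holds the polynomials that may still have size [d.+1]. A descent step removes one of them and
   adds only polynomials of size at most [d] to [S]; when [B] is empty, the bound has dropped. *)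
suff gen B S : {in B, forall p, (size p <= d.+1)%N} -> {in S, forall p, (size p <= d)%N} ->
    uniform (B ++ S).
  by rewrite -[P]cats0; apply: gen.
elim: B S => [|p B IHB] S hB hS; first by apply: IH.
apply: uniform_descent.
apply: (@uniform_sub (B ++ (p^`() :: degree_defect p :: S ++ pseudo_rems p (B ++ S)))).
  move=> x; rewrite /descent !(inE, mem_cat).
  by case: (x == p^`()); case: (x == degree_defect p); case: (x \in B); case: (x \in S).
have hBS q : q \in B ++ S -> (size q <= d.+1)%N.
  rewrite mem_cat => /orP[qB|/hS /leqW//]; by apply: hB; rewrite inE qB orbT.
have hp : (size p <= d.+1)%N by apply: hB; rewrite mem_head.
apply: IHB => [q qB|q]; first by apply: hB; rewrite inE qB orbT.
rewrite !inE mem_cat => /or4P[/eqP->|/eqP->|/hS//|].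
- have [->|p0] := eqVneq p 0; first by rewrite deriv0 size_poly0.
  by rewrite -ltnS (leq_trans (lt_size_deriv p0)).
- exact: size_degree_defect.
case/flattenP => _ /mapP[r rBS ->] /mapP[u]; rewrite mem_filter => /andP[u0].
case/mapP => j; rewrite mem_iota add0n ltnS => /andP[_ jr] uE ->.
rewrite -ltnS (leq_trans (ltn_rmodpN0 _ u0)) // uE.
by rewrite (leq_trans (size_take_poly _ _)) // (leq_trans jr) // hBS.
Qed.
End Uniform.

(** * Transfer of points in several variables *)

Section Transfer.
Variable D : comNzRingType.

Lemma mmap_muni (N : comNzRingType) (phi : {rmorphism D -> N}) k (x : 'I_k.+1 -> N) (p : {mpoly D[k.+1]}) :
  mmap phi x p =
  (map_poly (mmap phi (fun i => x (widen_ord (leqnSn k) i))) (muni p)).[x ord_max].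
Proof.
rewrite muniE rmorph_sum horner_sum; apply: eq_bigr => m _.
rewrite /= map_polyZ map_polyXn hornerZ hornerXn /= mmapZ mmapX -mulrA; congr (_ * _).
by rewrite /mmap1 big_ord_recr; congr (_ * _); apply: eq_bigr => i _; rewrite mnmE.
Qed.

Definition extend_point (N : Type) k (y : 'I_k -> N) (b : N) (i : 'I_k.+1) : N :=
  if unlift ord_max i is Some j then y j else b.

Lemma mmap_extend_point (N : comNzRingType) (phi : {rmorphism D -> N}) k (y : 'I_k -> N) b
    (p : {mpoly D[k.+1]}) :
  mmap phi (extend_point y b) p = (map_poly (mmap phi y) (muni p)).[b].
Proof.
rewrite mmap_muni /extend_point unlift_none; congr (_.[b]).
apply: eq_map_poly => q; apply: eq_bigr => m _; congr (_ * _); apply: eq_bigr => i _.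
suff -> : widen_ord (leqnSn k) i = lift ord_max i by rewrite liftK.
by apply: val_inj; rewrite /= /bump leqNgt ltn_ord.
Qed.

Variables (N1 N2 : rcfType) (phi1 : {rmorphism D -> N1}) (phi2 : {rmorphism D -> N2}).
Hypothesis phi_sg : forall c, same_signs phi1 phi2 c.

(** As [Q] does not depend on the evaluations, the first [k] coordinates can be transferred for [Q]
    by induction; the diagrams above them are then similar, and matching the last coordinate
    finishes. *)
Lemma sign_transfer k (P : seq {mpoly D[k]}) (x : 'I_k -> N1) :
  exists y : 'I_k -> N2, {in P, forall p, sgz (mmap phi1 x p) = sgz (mmap phi2 y p)}.
Proof.
elim: k P x => [|k IH] P x.
  have const (N : comNzRingType) (phi : {rmorphism D -> N}) z (p : {mpoly D[0]}) :
      mmap phi z p = phi (\sum_(m <- msupp p) p@_m).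
    by rewrite rmorph_sum; apply: eq_bigr => m _; rewrite /mmap1 big_ord0 mulr1.
  by exists (fun _ => 0) => p _; rewrite !const; apply: phi_sg.
have [Q hQ] := uniform_all N1 N2 [seq muni p | p <- P].
pose x' i := x (widen_ord (leqnSn k) i).
have [y hy] := IH Q x'.
have [rho [tot _ sg _]] := hQ (mmap phi1 x') (mmap phi2 y) hy.
have [b xb] := tot (x ord_max).
exists (extend_point y b) => p pP; rewrite mmap_muni mmap_extend_point.
have pin : (map_poly (mmap phi1 x') (muni p), map_poly (mmap phi2 y) (muni p)) \in
    images (mmap phi1 x') (mmap phi2 y) [seq muni p | p <- P].
  by apply/mapP; exists (muni p) => //; apply: map_f.
exact: (sg _ _ _ xb pin).
Qed.
End Transfer.

(** * Real closed extensions *)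

Section Precone.
Variable W : fieldType.
Implicit Types (T : W -> Prop).

(* A preordering of the subfield [T - T], which is not named separately. *)
Record precone T : Prop := Precone {
  pc_add : forall a b, T a -> T b -> T (a + b);
  pc_mul : forall a b, T a -> T b -> T (a * b);
  pc_inv : forall a, T a -> T a^-1;
  pc_1 : T 1;
  pc_N1 : ~ T (-1);
  pc_sq : forall a b, T a -> T b -> T ((a - b) ^+ 2) }.

Definition cone_span T x := exists a b, [/\ T a, T b & x = a - b].

Section Theory.
Variables (T : W -> Prop) (hT : precone T).

Lemma pc_0 : T 0.
Proof. by have := pc_sq hT (pc_1 hT) (pc_1 hT); rewrite subrr expr0n. Qed.

Lemma cone_span_mem a : T a -> cone_span T a.
Proof. by move=> Ta; exists a, 0; rewrite subr0; split=> //; apply: pc_0. Qed.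

Lemma cone_span_sub x y : cone_span T x -> cone_span T y -> cone_span T (x - y).
Proof.
move=> [a [b [Ta Tb ->]]] [c [d [Tc Td ->]]]; exists (a + d), (b + c).
by split; [exact: pc_add | exact: pc_add | ring].
Qed.

Lemma cone_span_mul x y : cone_span T x -> cone_span T y -> cone_span T (x * y).
Proof.
move=> [a [b [Ta Tb ->]]] [c [d [Tc Td ->]]]; exists (a * c + b * d), (a * d + b * c).
by split; [apply: (pc_add hT); exact: pc_mul | apply: (pc_add hT); exact: pc_mul | ring].
Qed.

Lemma cone_span_sq x : cone_span T x -> T (x ^+ 2).
Proof. by move=> [a [b [Ta Tb ->]]]; apply: pc_sq. Qed.

Lemma cone_span_inv x : cone_span T x -> cone_span T x^-1.
Proof.
move=> hx; have [->|x0] := eqVneq x 0; first by rewrite invr0; apply/cone_span_mem/pc_0.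
have -> : x^-1 = x * (x ^+ 2)^-1 by field.
by apply: cone_span_mul => //; apply/cone_span_mem/(pc_inv hT)/cone_span_sq.
Qed.

Lemma pc_anti a : T a -> T (- a) -> a = 0.
Proof.
move=> Ta TNa; apply/eqP/negPn/negP => a0; apply: (pc_N1 hT).
have -> : -1 = - a * a^-1 by rewrite mulNr divff.
by apply: (pc_mul hT) => //; apply: pc_inv.
Qed.

Definition maximal := forall T', precone T' -> (forall x, T x -> T' x) -> forall x, T' x -> T x.

Hypothesis Tmax : maximal.

(** If [x] is not in [T], then [T - x T] is a precone containing [T] and [- x], so maximality
    applies. It omits [-1]: [-1 = a - x * b] would put [x = (1 + a) / b] in [T], or [a = -1] if
    [b = 0]. *)
Lemma maximal_total x : cone_span T x -> T x \/ T (- x).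
Proof.
move=> hx; have [Tx|nTx] := EM (T x); [by left|right].
pose T' z := exists a b, [/\ T a, T b & z = a - x * b].
have spT' z : T' z -> cone_span T z.
  by move=> [a [b [Ta Tb ->]]]; apply: cone_span_sub; [|apply: cone_span_mul => //]; apply: cone_span_mem.
have T'mul a b : T' a -> T' b -> T' (a * b).
  move=> [a1 [a2 [h1 h2 ->]]] [b1 [b2 [h3 h4 ->]]].
  exists (a1 * b1 + x ^+ 2 * (a2 * b2)), (a1 * b2 + a2 * b1); split; last by ring.
    apply: (pc_add hT); apply: (pc_mul hT) => //; last exact: pc_mul.
    exact: cone_span_sq.
  by apply: (pc_add hT); apply: (pc_mul hT).
have TT' a : T a -> T' a.
  by move=> Ta; exists a, 0; rewrite mulr0 subr0; split=> //; apply: pc_0.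
apply: (Tmax (T' := T')) => //; last first.
  by exists 0, 1; rewrite mulr1 sub0r; split=> //; [apply: pc_0 | apply: pc_1].
split=> //.
- move=> _ _ [a1 [a2 [h1 h2 ->]]] [b1 [b2 [h3 h4 ->]]].
  by exists (a1 + b1), (a2 + b2); split; [exact: pc_add | exact: pc_add | ring].
- move=> a ha; have [->|a0] := eqVneq a 0; first by rewrite invr0; apply/TT'/pc_0.
  have -> : a^-1 = a * a^-1 ^+ 2 by field.
  by apply: T'mul => //; apply/TT'/cone_span_sq/cone_span_inv/spT'.
- exact: (TT' _ (pc_1 hT)).
- move=> [a [b [Ta Tb E]]].
  have {}E : x * b = 1 + a.
    by rewrite -[x * b](subKr a) -E opprK addrC.
  have [b0|b0] := eqVneq b 0.
    apply: (pc_N1 hT); suff -> : -1 = a by [].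
    by apply/eqP; rewrite eq_sym -addr_eq0 addrC -E b0 mulr0.
  apply: nTx; have -> : x = (1 + a) * b^-1.
    by apply: (mulIf b0); rewrite mulfVK // E; ring.
  by apply: (pc_mul hT); [apply: (pc_add hT) => //; apply: pc_1 | apply: pc_inv].
- by move=> a b ha hb; apply/TT'/cone_span_sq/cone_span_sub; apply: spT'.
Qed.
End Theory.
End Precone.

(** * The ordered field spanned by a total cone *)

Section OrderedSubfield.
Variables (W : fieldType) (T : W -> Prop) (hT : precone T).
Hypothesis Ttot : forall x, cone_span T x -> T x \/ T (- x).

Let S : {pred W} := [pred x | `[< cone_span T x >]].
Let SP x : reflect (cone_span T x) (x \in S). Proof. by rewrite inE; apply: asboolP. Qed.

Fact cone_span_divring : divring_closed S.
Proof.
split; first by apply/SP/cone_span_mem => //; apply: pc_1.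
  by move=> x y /SP hx /SP hy; apply/SP/cone_span_sub.
by move=> x y /SP hx /SP hy; apply/SP/cone_span_mul => //; apply: cone_span_inv.
Qed.
HB.instance Definition _ := GRing.isDivringClosed.Build W S cone_span_divring.

Definition ordered_span := {x : W | x \in S}.
HB.instance Definition _ := SubChoice.copy ordered_span {x : W | x \in S}.
HB.instance Definition _ := [SubChoice_isSubIntegralDomain of ordered_span by <:].
HB.instance Definition _ := [SubIntegralDomain_isSubField of ordered_span by <:].

Let le (x y : ordered_span) : bool := `[< T (val y - val x) >].
Let lt (x y : ordered_span) : bool := (y != x) && le x y.
Let norm (x : ordered_span) : ordered_span := if le 0 x then x else - x.

Let leP x y : reflect (T (val y - val x)) (le x y). Proof. exact: asboolP. Qed.

Let le0P x : reflect (T (val x)) (le 0 x).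
Proof. by have := leP 0 x; rewrite rmorph0 subr0. Qed.

Let lex0P x : reflect (T (- val x)) (le x 0).
Proof. by have := leP x 0; rewrite rmorph0 sub0r. Qed.

Fact ordered_span_add x y : le 0 x -> le 0 y -> le 0 (x + y).
Proof. by move=> /le0P hx /le0P hy; apply/le0P; rewrite rmorphD; apply: pc_add. Qed.

Fact ordered_span_mul x y : le 0 x -> le 0 y -> le 0 (x * y).
Proof. by move=> /le0P hx /le0P hy; apply/le0P; rewrite rmorphM; apply: pc_mul. Qed.

Fact ordered_span_anti x : le 0 x -> le x 0 -> x = 0.
Proof.
by move=> /le0P h1 /lex0P h2; apply: val_inj; rewrite rmorph0; apply: (pc_anti hT).
Qed.

Fact ordered_span_sub x y : le 0 (y - x) = le x y.
Proof. by apply/le0P/leP; rewrite rmorphB. Qed.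

Fact ordered_span_total x : le 0 x || le x 0.
Proof. by have /SP/Ttot := valP x; case=> [/le0P->//|/lex0P->]; rewrite orbT. Qed.

Fact ordered_span_normN x : norm (- x) = norm x.
Proof.
have leN : le 0 (- x) = le x 0 by apply/le0P/lex0P; rewrite rmorphN.
rewrite /norm leN; case/orP: (ordered_span_total x) => h; rewrite ?h ?opprK.
  by case: ifP => // /(ordered_span_anti h)->; rewrite oppr0.
by case: ifP => // h'; rewrite (ordered_span_anti h' h) oppr0.
Qed.

Fact ordered_span_norm x : le 0 x -> norm x = x.
Proof. by rewrite /norm => ->. Qed.

HB.instance Definition _ := Num.IntegralDomain_isLeReal.Build ordered_span
  ordered_span_add ordered_span_mul ordered_span_anti ordered_span_sub
  ordered_span_total ordered_span_normN ordered_span_norm (fun x y => erefl (lt x y)).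

Lemma ordered_subfield : exists (M : realFieldType) (i : {rmorphism M -> W}),
  (forall x, cone_span T x <-> exists y, i y = x) /\ forall y : M, (0 <= y) <-> T (i y).
Proof.
exists ordered_span, val; split=> [x|y].
  split=> [/SP hx|[y <-]]; first by exists (exist _ x hx : ordered_span).
  exact/SP/valP.
have -> : (0 <= y) = le 0 y by [].
by rewrite /le rmorph0 subr0; split=> /asboolP.
Qed.
End OrderedSubfield.

(** * Weighted sums of squares of polynomials *)

Section Weighted.
Variable M : realFieldType.
Implicit Types (p q g h : {poly M}).

(** The weights are there because a nonnegative element of [M] is not yet known to be a square. *)
Inductive wsos : {poly M} -> Prop :=
| wsos0 : wsos 0
| wsosD g c q of wsos g & 0 <= c : wsos (g + c *: q ^+ 2).

Lemma wsos_add g h : wsos g -> wsos h -> wsos (g + h).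
Proof.
move=> hg; elim=> [|{}h c q hh IH c0]; first by rewrite addr0.
by rewrite addrA; constructor.
Qed.

Lemma wsos_scale c q : 0 <= c -> wsos (c *: q ^+ 2).
Proof. by move=> c0; rewrite -[_ *: _]add0r; constructor=> //; constructor. Qed.

Lemma wsos_sq q : wsos (q ^+ 2).
Proof. by rewrite -[q ^+ 2]scale1r; apply: wsos_scale. Qed.

Lemma wsosC c : 0 <= c -> wsos c%:P.
Proof. by move=> c0; rewrite -[c%:P]mulr1 mul_polyC -(expr1n _ 2); apply: wsos_scale. Qed.

Lemma wsos_mul g h : wsos g -> wsos h -> wsos (g * h).
Proof.
move=> hg; elim=> [|{}h c q hh IH c0]; first by rewrite mulr0; constructor.
rewrite mulrDr; apply: wsos_add => // {IH hh}; elim: hg => [|{}g d r gg IHg d0].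
  by rewrite mul0r; constructor.
rewrite mulrDl; apply: wsos_add => //.
by rewrite -scalerAl -scalerAr scalerA -exprMn; apply: wsos_scale; apply: mulr_ge0.
Qed.

Lemma wsos_ge0 g x : wsos g -> 0 <= g.[x].
Proof.
elim=> [|{}g c q _ IH c0]; first by rewrite horner0.
by rewrite hornerD hornerZ horner_exp addr_ge0 // mulr_ge0 // sqr_ge0.
Qed.

(** Each [q] is replaced by its remainder modulo [p], of size at most [size p - 1], whose square has
    size at most [2 * (size p - 1) - 1]. *)
Lemma wsos_mod p g : p != 0 -> wsos g ->
  exists g', [/\ wsos g', (size g' <= (size p).*2 - 3)%N & p %| g - g'].
Proof.
move=> p0; elim=> [|{}g c q _ [g' [h1 h2 h3]] c0].
  by exists 0; rewrite subrr dvdp0 size_poly0; split=> //; constructor.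
exists (g' + c *: (q %% p) ^+ 2); split; first by constructor.
  rewrite (leq_trans (size_polyD _ _)) // geq_max h2 (leq_trans (size_scale_leq _ _)) //.
  have := ltn_modpN0 q p0; have := size_polyMleq (q %% p) (q %% p).
  rewrite -expr2; move: (size _) (size (q %% p)) (size p) => a b d; lia.
rewrite opprD addrACA dvdp_add // -scalerBr -mul_polyC dvdp_mull // subr_sqr dvdp_mulr //.
by rewrite {1}(divp_eq q p) addrK dvdp_mull.
Qed.
End Weighted.

(** * Maximal cones span real closed fields *)

Section RealClosed.
Variables (W : closedFieldType) (T : W -> Prop) (hT : precone T) (Tmax : maximal T).
Variables (M : realFieldType) (i : {rmorphism M -> W}).
Hypothesis iP : forall x, cone_span T x <-> exists y, i y = x.
Hypothesis iT : forall y, (0 <= y) <-> T (i y).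

Section Adjoin.
Variables (p : {poly M}) (alpha : W).
Hypothesis p_irr : irreducible_poly p.
Hypothesis p_alpha : root (map_poly i p) alpha.

Let ev g := (map_poly i g).[alpha].

(** Polynomials coprime over [M] stay coprime over [W], where they cannot share the root [alpha]. *)
Lemma irr_dvd g : ev g = 0 -> p %| g.
Proof.
move=> g0; case: p_irr => sp pd.
have := pd (gcdp p g); have [cop _|nc] := boolP (size (gcdp p g) == 1)%N.
  have : coprimep (map_poly i p) (map_poly i g) by rewrite coprimep_map /coprimep.
  by move/coprimep_root => /(_ _ p_alpha)/eqP.
by move/(_ isT (dvdp_gcdl _ _)) => e; rewrite -(eqp_dvdl _ e) dvdp_gcdr.
Qed.

Lemma adjoin_inv g : ev g != 0 -> exists h, ev h = (ev g)^-1.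
Proof.
move=> g0; have cop : coprimep p g.
  rewrite coprimep_sym; apply: contraT => nc; case: p_irr => sp pd.
  have e : gcdp g p %= p by apply: pd => //; exact: dvdp_gcdr.
  move: g0; have : p %| g by rewrite -(eqp_dvdl _ e) dvdp_gcdl.
  move=> /dvdpP[q ->]; rewrite /ev rmorphM hornerM /=.
  by rewrite (rootP p_alpha) mulr0 eqxx.
have /Bezout_eq1_coprimepP[[u v] /= uv] := cop.
exists v; apply: (mulIf g0); rewrite mulVf //.
have := congr1 ev uv; rewrite /ev rmorphD !rmorphM hornerD !hornerM /=.
by rewrite (rootP p_alpha) mulr0 add0r rmorph1 hornerC.
Qed.

(** The values at [alpha] of weighted sums of squares form a precone containing [T], hence lie in
    [T] by maximality. Then [alpha], the difference of the squares of [(alpha + 1) / 2] and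
    [(alpha - 1) / 2], comes from [M]. *)
Lemma adjoin_span : (forall g, wsos g -> ev g != -1) -> exists c, root p c.
Proof.
move=> noN1; pose T' z := exists2 g, wsos g & ev g = z.
have evM g h : ev (g * h) = ev g * ev h by rewrite /ev rmorphM hornerM.
have evD g h : ev (g + h) = ev g + ev h by rewrite /ev rmorphD hornerD.
have evB g h : ev (g - h) = ev g - ev h by rewrite /ev rmorphB hornerD hornerN.
have evC c : ev c%:P = i c by rewrite /ev map_polyC hornerC.
have hT' : precone T'.
  split.
  - by move=> _ _ [g hg <-] [h hh <-]; exists (g + h); [exact: wsos_add|].
  - by move=> _ _ [g hg <-] [h hh <-]; exists (g * h); [exact: wsos_mul|].
  - move=> _ [g hg <-]; have [->|g0] := eqVneq (ev g) 0.
      by rewrite invr0; exists 0; [constructor | rewrite /ev rmorph0 horner0].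
    have [h eh] := adjoin_inv g0; exists (g * h ^+ 2).
      by apply: wsos_mul => //; exact: wsos_sq.
    by rewrite expr2 !evM eh; field.
  - by exists 1; [rewrite -polyC1; apply: wsosC | rewrite -polyC1 evC rmorph1].
  - by case=> g /noN1/eqP.
  - move=> _ _ [g hg <-] [h hh <-]; exists ((g - h) ^+ 2); first exact: wsos_sq.
    by rewrite !expr2 evM !evB.
have TT' x : T x -> T' x.
  move=> Tx; have [y yx] := (iP x).1 (cone_span_mem hT Tx).
  by exists y%:P; [apply: wsosC; apply/iT; rewrite yx | rewrite evC].
have T'T := Tmax hT' TT'.
have half : (2 : M) != 0 by rewrite pnatr_eq0.
have /iP[c ic] : cone_span T alpha.
  have sqT q : T (ev (q ^+ 2)) by apply: T'T; exists (q ^+ 2) => //; exact: wsos_sq.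
  exists (ev ((2^-1%:P * ('X + 1)) ^+ 2)), (ev ((2^-1%:P * ('X - 1)) ^+ 2)); split=> //.
  rewrite -evB; suff -> : (2^-1%:P * ('X + 1)) ^+ 2 - (2^-1%:P * ('X - 1)) ^+ 2 = 'X :> {poly M}.
    by rewrite /ev map_polyX hornerX.
  have -> : (2^-1%:P * ('X + 1)) ^+ 2 - (2^-1%:P * ('X - 1)) ^+ 2 =
     (2^-1%:P * 2%:R) ^+ 2 * 'X :> {poly M} by ring.
  by rewrite -polyC_natr -polyCM mulVf // expr1n mul1r.
by exists c; move: p_alpha; rewrite -ic fmorph_root.
Qed.
End Adjoin.

(* Suppose [p] is irreducible with a root [alpha] outside the field. If [-1] were
   a weighted sum of squares in [alpha], then [1 + sum = h p] with [h] of smaller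
   degree and with a sign change, hence with a root, where [1 + sum] vanishes:
   absurd. So the cone extends to the adjunction of [alpha]. *)
Lemma sign_change_root n (p : {poly M}) a b : (size p <= n)%N -> a <= b -> p.[a] * p.[b] < 0 ->
  exists2 c, a <= c <= b & root p c.
Proof.
elim: n p a b => [|n IH] p a b sp ab pab.
  by move: pab; rewrite (size_poly_leq0P _ sp) !horner0 mulr0 ltxx.
have p0 : p != 0 by apply: contraTneq pab => ->; rewrite horner0 mul0r ltxx.
have sp1 : (1 < size p)%N.
  rewrite ltnNge; apply: contraTN pab => /size1_polyC ->.
  by rewrite !hornerC -leNgt -expr2 sqr_ge0.
(* If [p] splits into smaller factors, one of them changes sign. *)
have [[q [r [E sq sr]]]|irr] := EM (exists q r, [/\ p = q * r, (size q < size p)%N & (size r < size p)%N]).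
  have : q.[a] * q.[b] < 0 \/ r.[a] * r.[b] < 0.
    move: pab; rewrite E !hornerM mulrACA => h.
    case: (ltP (q.[a] * q.[b]) 0) => [|q1]; first by left.
    by right; rewrite ltNge; apply: contraTN h => r1; rewrite -leNgt mulr_ge0.
  case=> h.
    by have [|c cab qc] := IH q a b _ ab h; [rewrite -ltnS (leq_trans sq) | exists c => //; rewrite E rootM qc].
  by have [|c cab qc] := IH r a b _ ab h; [rewrite -ltnS (leq_trans sr) | exists c => //; rewrite E rootM qc orbT].
have p_irr : irreducible_poly p.
  split=> // q q1 qp; rewrite -dvdp_size_eqp // eqn_leq dvdp_leq //= leqNgt.
  apply/negP => sq; apply: irr; exists (p %/ q), q.
  have q0 : q != 0 by apply: dvdpN0 qp p0.
  split=> //; first by rewrite divpK.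
  rewrite size_divp //; move: q1 q0; rewrite -size_poly_eq0.
  move: (size _) (size _) sp1 => u v; lia.
have [alpha pa] : exists alpha, root (map_poly i p) alpha.
  by apply/closed_rootP; rewrite size_map_poly neq_ltn sp1 orbT.
have [|c pc] := adjoin_span p_irr pa.
  move=> g wg; apply/eqP => gN1.
  have [g' [wg' sg' dg']] := wsos_mod p0 wg.
  have evg' : (map_poly i g').[alpha] = -1.
    have /dvdpP[q /(congr1 (fun r => (map_poly i r).[alpha]))] := dg'.
    rewrite rmorphB rmorphM hornerM /= (rootP pa) mulr0 hornerD hornerN gN1.
    by move/eqP; rewrite subr_eq0 => /eqP.
  have /dvdpP[h hE] : p %| g' + 1.
    apply: (irr_dvd p_irr pa).
    by rewrite rmorphD rmorph1 hornerD hornerC evg' addNr.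
  have pos x : 0 < h.[x] * p.[x].
    by rewrite -hornerM -hE hornerD hornerC ltr_wpDl ?wsos_ge0.
  have h0 : h != 0.
    by apply: contraTneq (pos a) => ->; rewrite horner0 mul0r ltxx.
  (* Since [h * p] has size at most [2 * size p - 3], [h] is shorter than [p]. *)
  have sh : (size h <= n)%N.
    have : (size (h * p)%R <= maxn ((size p).*2 - 3) 1)%N.
      rewrite -hE (leq_trans (size_polyD _ _)) // geq_max size_polyC oner_eq0 /=.
      by rewrite leq_max sg' leq_maxr.
    rewrite size_mul //; move: (size h) (size p) sp sp1 => u v; lia.
  have hab : h.[a] * h.[b] < 0.
    have := mulr_gt0 (pos a) (pos b); rewrite mulrACA.
    by rewrite (nmulr_lgt0 _ pab).
  have [c _ hc] := IH h a b sh ab hab.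
  by have := pos c; rewrite (rootP hc) mul0r ltxx.
exists c => //.
(* The root [c] comes without location. Irreducibility makes [p] a constant multiple of ['X - c%:P],
   and the sign change then puts [c] between [a] and [b]. *)
have cp : 'X - c%:P %| p by rewrite dvdp_XsubCl.
have := p_irr.2 _ _ cp; rewrite size_XsubC => /(_ isT) e.
have /dvdpP[k kE] := cp; have k1 : (size k <= 1)%N.
  have k0 : k != 0 by apply: contraNneq p0 => k0; rewrite kE k0 mul0r.
  have := eqp_size e; rewrite kE size_Mmonic ?monicXsubC // size_XsubC addn2 /=.
  by move=> [<-].
move: pab; rewrite kE (size1_polyC k1) !hornerM !hornerXsubC !hornerC mulrACA -expr2 => pab.
have {}pab : (a - c) * (b - c) < 0.
  by rewrite ltNge; apply: contraTN pab => h; rewrite -leNgt mulr_ge0 ?sqr_ge0.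
by apply/andP; split; rewrite leNgt; apply/negP => ?; nra.
Qed.

Lemma maximal_real_closed : Num.real_closed_axiom M.
Proof.
move=> p a b ab /andP[pa pb].
have [pa0|pa0] := eqVneq p.[a] 0; first by exists a; rewrite ?lexx //; apply/rootP.
have [pb0|pb0] := eqVneq p.[b] 0; first by exists b; rewrite ?lexx ?ab //; apply/rootP.
apply: (sign_change_root (leqnn _) ab).
by rewrite nmulr_rlt0 lt_neqAle ?pa0 // eq_sym pb0.
Qed.
End RealClosed.

(** Zorn's lemma is applied to the sets [A] whose union with [T0] is a precone, so that the empty
    union of the empty chain qualifies. *)
Lemma maximal_precone (W : fieldType) (T0 : W -> Prop) : precone T0 ->
  exists T, [/\ precone T, maximal T & forall x, T0 x -> T x].
Proof.
move=> h0; pose P (A : set W) := precone (fun x => T0 x \/ A x).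
have [|A [PA Amax]] := @Zorn_bigcup W P.
  move=> F FP Ftot; pose U := fun x => T0 x \/ bigcup F id x.
  (* Each axiom involves at most two elements, and a chain puts both into one precone inside [U]. *)
  have common a b : U a -> U b -> exists2 T : W -> Prop,
      precone T & [/\ T a, T b & forall x, T x -> U x].
    have sub X : F X -> forall x, T0 x \/ X x -> U x.
      by move=> FX x [|Xx]; [left | right; exists X].
    case=> [a0|[X FX Xa]] [b0|[Y FY Yb]].
    - by exists T0 => //; split=> // x; left.
    - by exists (fun x => T0 x \/ Y x); [exact: (FP _ FY) | split; [left|right|exact: (sub _ FY)]].
    - by exists (fun x => T0 x \/ X x); [exact: (FP _ FX) | split; [right|left|exact: (sub _ FX)]].
    - case: (Ftot _ _ FX FY) => XY.
        exists (fun x => T0 x \/ Y x); [exact: (FP _ FY) | split; [right|right|exact: (sub _ FY)]] => //.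
        exact: XY.
      exists (fun x => T0 x \/ X x); [exact: (FP _ FX) | split; [right|right|exact: (sub _ FX)]] => //.
      exact: XY.
  split.
  - by move=> a b ha hb; have [T hT [Ta Tb TU]] := common a b ha hb; apply: TU; exact: pc_add.
  - by move=> a b ha hb; have [T hT [Ta Tb TU]] := common a b ha hb; apply: TU; exact: pc_mul.
  - by move=> a ha; have [T hT [Ta _ TU]] := common a a ha ha; apply: TU; exact: pc_inv.
  - by left; apply: pc_1.
  - by move=> hN; have [T hT [TN _ _]] := common _ _ hN hN; apply: (pc_N1 hT).
  - by move=> a b ha hb; have [T hT [Ta Tb TU]] := common a b ha hb; apply: TU; exact: pc_sq.
exists (fun x => T0 x \/ A x); split=> // [T hT AT x Tx|x]; last by left.
have [Ax|nAx] := EM (A x); first by right.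
have TA : precone (fun x => T0 x \/ T x).
  suff -> : (fun x => T0 x \/ T x) = T by [].
  by apply: funext => y; apply: propext; split=> [[y0|//]|]; [apply: AT; left | right].
case: (Amax T) => //; split; last by move=> /(_ x Tx) /nAx.
by move=> y Ay; apply: AT; right.
Qed.

(** * Countable subfields and their real closed extensions *)

Section CountableSubfield.
Variables (L : fieldType) (e : nat -> L).

(* Labels 0 and 1 encode subtraction and division. *)
Fixpoint eval_expr (t : GenTree.tree nat) : L :=
  match t with
  | GenTree.Leaf n => e n
  | GenTree.Node 0 [:: a; b] => eval_expr a - eval_expr b
  | GenTree.Node 1 [:: a; b] => eval_expr a / eval_expr b
  | _ => 1
  end.

Let S : {pred L} := [pred x | `[< exists t, eval_expr t = x >]].
Let SP x : reflect (exists t, eval_expr t = x) (x \in S).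
Proof. by rewrite inE; apply: asboolP. Qed.

Fact generated_divring : divring_closed S.
Proof.
split; first by apply/SP; exists (GenTree.Node 2 [::]).
  by move=> _ _ /SP[a <-] /SP[b <-]; apply/SP; exists (GenTree.Node 0 [:: a; b]).
by move=> _ _ /SP[a <-] /SP[b <-]; apply/SP; exists (GenTree.Node 1 [:: a; b]).
Qed.
HB.instance Definition _ := GRing.isDivringClosed.Build L S generated_divring.

Definition generated_field := {x : L | x \in S}.
HB.instance Definition _ := SubChoice.copy generated_field {x : L | x \in S}.
HB.instance Definition _ := [SubChoice_isSubIntegralDomain of generated_field by <:].
HB.instance Definition _ := [SubIntegralDomain_isSubField of generated_field by <:].

Let expr_of (x : generated_field) : GenTree.tree nat := projT1 (cid (SP _ (valP x))).
Let expr_ofK : pcancel expr_of (fun t => insub (eval_expr t)).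
Proof.
by move=> x; rewrite /expr_of; case: cid => t /= ->; rewrite valK.
Qed.
HB.instance Definition _ := PCanIsCountable expr_ofK.

Lemma countable_subfield : exists (K : countFieldType) (i : {rmorphism K -> L}),
  forall n, exists k, i k = e n.
Proof.
exists generated_field, val => n.
have eS : e n \in S by apply/SP; exists (GenTree.Leaf n).
by exists (exist _ (e n) eS : generated_field).
Qed.
End CountableSubfield.

Record preordering (L : fieldType) (P : L -> Prop) : Prop := Preordering {
  po_add : forall a b, P a -> P b -> P (a + b);
  po_mul : forall a b, P a -> P b -> P (a * b);
  po_sq : forall a, P (a ^+ 2);
  po_N1 : ~ P (-1) }.

(* Only the countable field [K] generated by [e] is ordered, because algebraic
   closures are available for countable fields only. *)
Lemma real_closed_extension (L : fieldType) (P : L -> Prop) (e : nat -> L) :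
  preordering P ->
  exists (K : fieldType) (i : {rmorphism K -> L}) (M : rcfType) (j : {rmorphism K -> M}),
    (forall n, exists k, i k = e n) /\ forall k, P (i k) -> 0 <= j k.
Proof.
move=> [PD PM Psq PN1].
have [K [i hi]] := countable_subfield e; exists K, i.
have [W [w _]] := countable_algebraic_closure K.
pose T0 x := exists2 k, P (i k) & w k = x.
have h0 : precone T0.
  split.
  - by move=> _ _ [a Pa <-] [b Pb <-]; exists (a + b); rewrite rmorphD //; apply: PD.
  - by move=> _ _ [a Pa <-] [b Pb <-]; exists (a * b); rewrite rmorphM //; apply: PM.
  - move=> _ [a Pa <-]; exists a^-1; rewrite fmorphV //.
    have [->|a0] := eqVneq a 0; first by rewrite rmorph0 invr0; have := Psq 0; rewrite expr0n.
    have -> : (i a)^-1 = i a * (i a)^-1 ^+ 2 by field; rewrite fmorph_eq0.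
    exact: PM.
  - by exists 1; rewrite rmorph1 //; have := Psq 1; rewrite expr1n.
  - case=> k Pk /eqP; rewrite -(rmorphN1 w) (inj_eq (fmorph_inj w)) => /eqP kE.
    by apply: PN1; rewrite -(rmorphN1 i) -kE.
  - by move=> _ _ [a Pa <-] [b Pb <-]; exists ((a - b) ^+ 2); rewrite ?rmorphXn ?rmorphB.
have [T [hT Tmax TT]] := maximal_precone h0.
have [M [m [mspan mpos]]] := ordered_subfield hT (maximal_total hT Tmax).
have rc := maximal_real_closed hT Tmax mspan mpos.
pose MR : rcfType := HB.pack M (Num.RealField_isClosed.Build M rc).
(* In characteristic two, [-1 = 1] would be a square. *)
have two : (2 : K) != 0.
  apply/eqP => two; apply: PN1.
  have -> : -1 = 1 - i 2 by rewrite rmorph_nat; ring.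
  by rewrite two rmorph0 subr0; have := Psq 1; rewrite expr1n.
(* Every [k] is a difference of two squares, so its image lies in the span of [T] and comes from
   [M]; injectivity of [m] makes the chosen preimages a ring morphism. *)
have sp k : {y : MR | m y = w k}.
  apply: cid; apply/mspan.
  exists (w (((k + 1) / 2) ^+ 2)), (w (((k - 1) / 2) ^+ 2)); split.
  - by apply: TT; exists (((k + 1) / 2) ^+ 2); rewrite // rmorphXn.
  - by apply: TT; exists (((k - 1) / 2) ^+ 2); rewrite // rmorphXn.
  by rewrite -rmorphB; congr (w _); field.
pose j k : MR := sval (sp k).
have jE k : m (j k) = w k by apply: (svalP (sp k)).
have jB : zmod_morphism j.
  by move=> x y; apply: (fmorph_inj m); rewrite rmorphB !jE rmorphB.
have jM : monoid_morphism j.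
  by split=> [|x y]; apply: (fmorph_inj m); rewrite ?rmorph1 ?rmorphM !jE ?rmorph1 ?rmorphM.
pose jR : {rmorphism K -> MR} :=
  HB.pack j (GRing.isZmodMorphism.Build K MR j jB) (GRing.isMonoidMorphism.Build K MR j jM).
exists MR, jR; split=> // k Pk; apply/mpos; rewrite jE.
by apply: TT; exists k.
Qed.

(** * Artin's theorem *)

Section SumsOfSquares.
Variable L : fieldType.
Implicit Types a b x : L.

Definition sos x := exists s : seq L, x = \sum_(a <- s) a ^+ 2.

Lemma sos0 : sos 0. Proof. by exists [::]; rewrite big_nil. Qed.

Lemma sos_sq a : sos (a ^+ 2). Proof. by exists [:: a]; rewrite big_seq1. Qed.

Lemma sos1 : sos 1. Proof. by rewrite -(expr1n _ 2); apply: sos_sq. Qed.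

Lemma sosD a b : sos a -> sos b -> sos (a + b).
Proof. by move=> [s ->] [t ->]; exists (s ++ t); rewrite big_cat. Qed.

Lemma sosM a b : sos a -> sos b -> sos (a * b).
Proof.
move=> [s ->] [t ->]; exists [seq x * y | x <- s, y <- t].
rewrite big_allpairs_dep big_distrl; apply: eq_bigr => x _; rewrite big_distrr.
by apply: eq_bigr => y _; rewrite exprMn.
Qed.

(** From [-1 = a - x * b] follows [x = (1 + a) * b / b ^+ 2], a sum of squares. If [b = 0], then
    [-1] is a sum of squares and so is every element. *)
Lemma preordering_adjoin x : (2 : L) != 0 -> ~ sos x ->
  preordering (fun z => exists a b, [/\ sos a, sos b & z = a - x * b]).
Proof.
move=> two nx; split.
- move=> _ _ [a [b [ha hb ->]]] [c [d [hc hd ->]]].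
  by exists (a + c), (b + d); split; [exact: sosD | exact: sosD | ring].
- move=> _ _ [a [b [ha hb ->]]] [c [d [hc hd ->]]].
  exists (a * c + x ^+ 2 * (b * d)), (a * d + b * c); split; last by ring.
    by apply: sosD; [exact: sosM | apply: sosM (sos_sq x) (sosM hb hd)].
  by apply: sosD; exact: sosM.
- by move=> a; exists (a ^+ 2), 0; rewrite mulr0 subr0; split; [exact: sos_sq | exact: sos0|].
move=> [a [b [ha hb E]]]; apply: nx.
have {}E : x * b = 1 + a by rewrite -[x * b](subKr a) -E opprK addrC.
have [b0|b0] := eqVneq b 0.
  have aN1 : a = -1 by apply/eqP; rewrite -addr_eq0 addrC -E b0 mulr0.
  have -> : x = ((x + 1) / 2) ^+ 2 + a * ((x - 1) / 2) ^+ 2 by rewrite aN1; field.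
  by apply: sosD (sos_sq _) (sosM ha (sos_sq _)).
have -> : x = (1 + a) * b * b^-1 ^+ 2 by rewrite -E; field.
by apply: sosM (sosM (sosD sos1 ha) hb) (sos_sq _).
Qed.
End SumsOfSquares.

Lemma rmorph_mmap (D : nzRingType) (A B : comNzRingType) n (f : {rmorphism D -> A})
    (g : {rmorphism A -> B}) (h : 'I_n -> A) (p : {mpoly D[n]}) :
  g (mmap f h p) = mmap (g \o f) (g \o h) p.
Proof.
rewrite rmorph_sum; apply: eq_bigr => m _; rewrite rmorphM rmorph_prod /=.
by congr (_ * _); apply: eq_bigr => i _; rewrite rmorphXn.
Qed.

Section Artin.
Variables (R : rcfType) (m : nat).
Local Notation L := {fraction {mpoly R[m]}}.

Lemma tofrac_mpolyC_sos (r : R) : 0 <= r -> sos (tofrac r%:MP : L).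
Proof.
move=> r0; have -> : (tofrac r%:MP : L) = (tofrac (Num.sqrt r)%:MP) ^+ 2.
  by rewrite -!rmorphXn /= sqr_sqrtr.
exact: sos_sq.
Qed.

Theorem artin (f : {mpoly R[m]}) : (forall c, 0 <= f.@[c]) -> sos (tofrac f : L).
Proof.
move=> f_ge0; apply: contrapT => nsos.
have two : (2 : L) != 0.
  by rewrite -(rmorph_nat (@tofrac _)) tofrac_eq0 -mpolyC_nat mpolyC_eq0 pnatr_eq0.
have hP := preordering_adjoin two nsos; set P := (fun z => _) in hP.
have sosP z : sos z -> P z.
  by move=> hz; exists z, 0; rewrite mulr0 subr0; split=> //; apply: sos0.
pose N := size (msupp f); pose mon (l : 'I_N) := nth 0%MM (msupp f) l.
pose cf (l : 'I_N) : R := f@_(mon l).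
pose s : seq L := [seq tofrac (cf l)%:MP | l <- enum 'I_N] ++ [seq tofrac 'X_l | l <- enum 'I_m].
have [K [i [M [j [hi hj]]]]] := real_closed_extension (nth 0 s) hP.
have hs z : z \in s -> {k | i k = z}.
  by move=> zs; apply: cid; have [k ik] := hi (index z s); exists k; rewrite ik nth_index.
have hy l : {k | i k = tofrac (cf l)%:MP}.
  by apply: hs; rewrite mem_cat; apply/orP; left; apply/mapP; exists l; rewrite ?mem_enum.
have hx l : {k | i k = tofrac 'X_l}.
  by apply: hs; rewrite mem_cat; apply/orP; right; apply/mapP; exists l; rewrite ?mem_enum.
pose y l := sval (hy l); pose x l := sval (hx l).
(* Integer polynomials in [N] variables stand for expressions in the coefficients of [f]; this
   common source is evaluated both in [M] and in [R]. *)
pose phiK : {rmorphism {mpoly int[N]} -> K} := mmap intr y.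
pose phi1 : {rmorphism {mpoly int[N]} -> M} := j \o phiK.
pose phi2 : {rmorphism {mpoly int[N]} -> R} := mmap intr cf.
pose const : {rmorphism R -> L} := @tofrac _ \o @mpolyC m R.
have phiE q : i (phiK q) = const (phi2 q).
  rewrite /phiK /phi2 /= rmorph_mmap [RHS](rmorph_mmap _ const); apply: eq_bigr => mo _.
  rewrite /= !rmorph_int; congr (_ * _); apply: eq_bigr => l _.
  by rewrite /= (svalP (hy l)).
(* A positive real constant is a square, hence lies in [P] and is nonnegative in [M]; injectivity
   excludes zero. *)
have pos q : 0 < phi2 q -> 0 < phi1 q.
  move=> q0; have hq : 0 <= phi1 q.
    by apply: hj; rewrite phiE; apply/sosP/tofrac_mpolyC_sos/ltW.
  rewrite lt_neqAle hq andbT eq_sym fmorph_eq0 -(fmorph_eq0 i) phiE.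
  by rewrite fmorph_eq0 gt_eqF.
have sg q : same_signs phi1 phi2 q.
  rewrite /same_signs; case: (sgzP (phi2 q)) => [q0|/pos/gtr0_sgz//|q0].
    suff -> : phi1 q = 0 by rewrite sgz0.
    by apply/eqP; rewrite fmorph_eq0 -(fmorph_eq0 i) phiE q0 rmorph0.
  by rewrite ltr0_sgz // -oppr_gt0 -rmorphN pos // rmorphN oppr_gt0.
(* [f0] is [f] with its coefficients replaced by indeterminates, which [phi2] turns back. *)
pose f0 : {mpoly {mpoly int[N]}[m]} := \sum_(l < N) 'X_l *: 'X_[mon l].
have f0E (A : comNzRingType) (phi : {rmorphism {mpoly int[N]} -> A}) z :
    mmap phi z f0 = \sum_(l < N) phi 'X_l * mmap1 z (mon l).
  by rewrite rmorph_sum; apply: eq_bigr => l _; rewrite /= mmapZ mmapX.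
have iF : i (mmap phiK x f0) = tofrac f.
  rewrite f0E rmorph_sum [f in RHS]mpolyE (big_nth 0%MM) big_mkord rmorph_sum.
  apply: eq_bigr => l _; rewrite rmorphM phiE /phi2 /= mmapX mmap1U.
  rewrite -mul_mpolyC rmorphM; congr (_ * _).
  rewrite mpolyXE_id !rmorph_prod; apply: eq_bigr => k _.
  by rewrite !rmorphXn /= (svalP (hx k)).
pose v := mmap phi1 (j \o x) f0.
have vE : v = j (mmap phiK x f0) by rewrite rmorph_mmap.
have v_lt0 : v < 0.
  rewrite lt_neqAle vE fmorph_eq0 -(fmorph_eq0 i) iF; apply/andP; split.
    by apply/eqP => F0; apply: nsos; rewrite F0; apply: sos0.
  rewrite -oppr_ge0 -rmorphN; apply: hj; rewrite rmorphN iF.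
  by exists 0, 1; rewrite mulr1 sub0r; split; [exact: sos0 | exact: sos1 |].
have [c hc] := sign_transfer sg [:: f0] (j \o x).
have := hc f0 (mem_head _ _); rewrite -/v ltr0_sgz // f0E => /esym/eqP.
rewrite sgz_cp0 ltNge; apply/negP/negPn.
have := f_ge0 c; rewrite mevalE (big_nth 0%MM) big_mkord.
by congr (0 <= _); apply: eq_bigr => l _; rewrite /phi2 /= mmapX mmap1U.
Qed.
End Artin.

(** * Matrices *)

Local Open Scope sesquilinear_scope.
(** The spectral theorem is used over the complex extension of [R]. The eigenvalues there are real,
    hence eigenvalues of [M], and the form is a sum of terms [d 0 j] times the squared modulus of
    [w 0 j]. *)
Lemma psd_quadratic_form (R : rcfType) n (M : 'M[R]_n) : M^T = M ->
  (forall a, eigenvalue M a -> 0 <= a) -> forall u : 'rV_n, 0 <= (u *m M *m u^T) 0 0.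
Proof.
move=> Msym Mpos u; pose rc := real_complex R; pose A := map_mx rc M.
have Areal k l (B : 'M[R]_(k, l)) : map_mx rc B \is a realmx.
  by apply/mxOverP => i j; rewrite mxE; apply/complex_realP; exists (B i j).
have Asym : A \is symmetricmx.
  by apply/is_hermitianmxP; rewrite expr0 scale1r map_mx_id // /A map_trmx Msym.
have Aherm := realsym_hermsym Asym (Areal _ _ M).
have /orthomx_spectralP := hermitian_normalmx Aherm.
set P := spectralmx A; set d := spectral_diag A => AE.
have PU : P \is unitarymx := spectral_unitarymx A.
have Pu : P \in unitmx := spectral_unit A.
have d_ge0 j : 0 <= d 0 j.
  have /mxOverP/(_ 0 j)/complex_realP[a da] := hermitian_spectral_diag_real Aherm.
  rewrite -/d in da; rewrite da ler0c; apply: Mpos.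
  rewrite -(eigenvalue_map rc) -/A; apply/eigenvalueP; exists (row j P).
    rewrite -row_mul AE !mulmxA mulmxV // mul1mx row_mul row_diag_mx -scalemxAl -rowE.
    by rewrite da.
  apply: contraL Pu => /eqP r0; apply/negP => Pu.
  have := congr1 (fun r => r *m invmx P) r0; rewrite -row_mul mulmxV // mul0mx.
  by move/rowP/(_ j); rewrite !mxE eqxx => /eqP; rewrite oner_eq0.
pose v := map_mx rc u.
have vv : v ^t* = v^T.
  by rewrite /v -map_trmx realmxC // ; rewrite map_trmx.
rewrite -ler0c.
have -> : ((u *m M *m u^T) 0 0)%:C%C = (v *m A *m v^T) 0 0.
  by rewrite /v /A map_trmx -!map_mxM [RHS]mxE.
pose w := v *m invmx P.
have -> : v *m A *m v^T = w *m diag_mx d *m w ^t*.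
  rewrite AE /w trmx_mul map_mxM invmx_unitary // trmxCK !mulmxA; congr (_ *m _).
  by rewrite vv.
rewrite mul_mx_diag mxE; apply: sumr_ge0 => j _.
by rewrite !mxE mulrAC mulr_ge0 // mul_conjC_ge0.
Qed.
Local Close Scope sesquilinear_scope.

Lemma meval_eq0 (R : rcfType) m (f : {mpoly R[m]}) : (forall c, f.@[c] = 0) -> f = 0.
Proof.
elim: m f => [|m IH] f f0.
  have E : f = (f@_0)%:MP.
    apply/mpolyP => mo; rewrite mcoeffC; suff -> : mo = 0%MM by rewrite eqxx mulr1.
    by apply/mnmP => -[].
  by move: (f0 (fun _ => 0)); rewrite E mevalC => ->; rewrite mpolyC0.
have uf0 : muni f = 0.
  apply/polyP => i; rewrite coef0; apply: IH => c.
  have /(congr1 (fun q : {poly R} => q`_i)) : map_poly (meval c) (muni f) = 0.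
    apply: sgz_poly_eq0 => b.
    by have := f0 (extend_point c b); rewrite /meval mmap_extend_point => ->; rewrite sgz0.
  by rewrite coef_map coef0.
(* Evaluating at the variables themselves recovers [f] from [muni f]. *)
by rewrite -[f]comp_mpoly_id /comp_mpoly mmap_muni uf0 rmorph0 horner0.
Qed.

Lemma fraction_repr (D : idomainType) (x : {fraction D}) :
  exists n d : D, d != 0 /\ x * tofrac d = tofrac n.
Proof.
elim/quotW: x => r; exists r.1, r.2; split; first exact: denom_ratioP.
unlock tofrac; rewrite -[LHS]FracField.pi_mul; apply/eqmodP.
rewrite /= FracField.equivfE /FracField.mulf !numden_Ratio ?mulf_neq0 ?denom_ratioP ?oner_neq0 //.
by rewrite !mulr1 mulrC.
Qed.

Section FormallyReal.
Variables (R : rcfType) (m : nat).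
Local Notation L := {fraction {mpoly R[m]}}.

Lemma common_denominator (D : idomainType) (s : seq {fraction D}) :
  exists (d : D) (g : seq D), d != 0 /\ [seq x * tofrac d | x <- s] = map (@tofrac D) g.
Proof.
elim: s => [|x s [d [g [d0 dg]]]]; first by exists 1, [::]; rewrite oner_neq0.
have [n [e [e0 xe]]] := fraction_repr x.
exists (d * e), (n * d :: [seq h * e | h <- g]); split; first exact: mulf_neq0.
rewrite /= !rmorphM mulrCA [tofrac d * _]mulrC xe; congr (_ :: _).
transitivity [seq y * tofrac e | y <- [seq x * tofrac d | x <- s]].
  by rewrite -map_comp; apply: eq_map => y /=; rewrite mulrA.
by rewrite dg -!map_comp; apply: eq_map => h /=; rewrite rmorphM.
Qed.

(** Clear denominators and evaluate at each real point, where a vanishing sum of squares has zero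
    terms. *)
Lemma sum_sqr_eq0 (s : seq L) : \sum_(x <- s) x ^+ 2 = 0 -> {in s, forall x, x = 0}.
Proof.
move=> s0; have [d [g [d0 dg]]] := common_denominator s.
have g0 : \sum_(h <- g) h ^+ 2 = 0.
  apply/eqP; rewrite -tofrac_eq0 rmorph_sum; apply/eqP.
  transitivity (\sum_(h <- map (@tofrac _) g) h ^+ 2 : L).
    by rewrite big_map; apply: eq_bigr => h _; rewrite rmorphXn.
  rewrite -dg big_map.
  transitivity ((\sum_(x <- s) x ^+ 2) * tofrac d ^+ 2); last by rewrite s0 mul0r.
  by rewrite mulr_suml; apply: eq_bigr => x _; rewrite exprMn.
have {}g0 h : h \in g -> h = 0.
  move=> hg; apply: meval_eq0 => c.
  have /eqP := congr1 (meval c) g0; rewrite rmorph_sum rmorph0 /=.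
  rewrite psumr_eq0 => [/allP/(_ h hg)|k _]; last by rewrite rmorphXn sqr_ge0.
  by rewrite /= rmorphXn sqrf_eq0 => /eqP.
move=> x xs; have : x * tofrac d \in [seq x * tofrac d | x <- s] by apply: map_f.
rewrite dg => /mapP[h /g0 -> /eqP].
by rewrite rmorph0 mulf_eq0 tofrac_eq0 (negPf d0) orbF => /eqP.
Qed.
End FormallyReal.

(** * Sums of rank-one matrices *)

Section Gram.
Variable L : fieldType.
Implicit Types n : nat.

Definition gram n (M : 'M[L]_n) := exists s : seq 'rV_n, M = \sum_(w <- s) w^T *m w.

Lemma gramD n (M N : 'M[L]_n) : gram M -> gram N -> gram (M + N).
Proof. by move=> [s ->] [t ->]; exists (s ++ t); rewrite big_cat. Qed.

Lemma gramZ n a (M : 'M[L]_n) : sos a -> gram M -> gram (a *: M).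
Proof.
move=> [s ->] [t ->]; exists [seq b *: w | b <- s, w <- t].
rewrite big_allpairs_dep scaler_suml; apply: eq_bigr => b _.
rewrite scaler_sumr; apply: eq_bigr => w _.
by rewrite [(_ *: _)^T]linearZ /= -scalemxAl -scalemxAr scalerA expr2.
Qed.

Lemma gram1 n (w : 'rV[L]_n) : gram (w^T *m w).
Proof. by exists [:: w]; rewrite big_seq1. Qed.

Lemma gram_block n (M : 'M[L]_n) : gram M -> gram (block_mx 0 0 0 M : 'M_(1 + n)).
Proof.
move=> [s ->]; exists [seq row_mx 0 w | w <- s]; rewrite big_map.
elim: s => [|w s IH]; first by rewrite !big_nil block_mx0.
rewrite !big_cons -IH tr_row_mx mul_col_row trmx0 !mul0mx mulmx0.
by rewrite add_block_mx !addr0.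
Qed.

(* [(w^T w)^2 = q (w^T w)] with [q = w w^T], and [1 / q = \sum_i (w_i / q)^2]. *)
Lemma gram_sum_squares n (M : 'M[L]_n) : gram M ->
  (forall s : seq L, \sum_(x <- s) x ^+ 2 = 0 -> {in s, forall x, x = 0}) ->
  exists s : seq 'M[L]_n, {in s, forall B, B^T = B} /\ M = \sum_(B <- s) B ^+ 2.
Proof.
move=> [s ->] real; elim: s => [|w s [t [tsym tE]]].
  by exists [::]; rewrite !big_nil.
have [->|w0] := eqVneq w 0.
  by exists t; split=> //; rewrite big_cons mulmx0 add0r tE.
pose q := \sum_i w 0 i ^+ 2.
have q0 : q != 0.
  apply: contra w0 => /eqP q0; apply/eqP/rowP => i; rewrite mxE.
  apply: (real [seq w 0 j | j <- enum 'I_n]); last by apply: map_f; rewrite mem_enum.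
  by rewrite big_map big_enum.
exists ([seq (w 0 i / q) *: (w^T *m w) | i <- enum 'I_n] ++ t); split.
  move=> B; rewrite mem_cat => /orP[/mapP[i _ ->]|/tsym//].
  by rewrite linearZ /= trmx_mul trmxK.
rewrite big_cons tE big_cat; congr (_ + _); rewrite big_map big_enum /=.
have wwT : w *m w^T = q%:M.
  by rewrite [LHS]mx11_scalar mxE; congr (_%:M); apply: eq_bigr => i _; rewrite mxE -expr2.
have sq : (w^T *m w) *m (w^T *m w) = q *: (w^T *m w).
  by rewrite mulmxA -[_ *m _ *m w^T]mulmxA wwT mul_mx_scalar -scalemxAl.
have sqZ c : (c *: (w^T *m w)) ^+ 2 = (c ^+ 2 * q) *: (w^T *m w).
  rewrite [LHS](_ : _ = (c *: (w^T *m w)) *m (c *: (w^T *m w))) //.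
  by rewrite -scalemxAl -scalemxAr sq !scalerA.
under eq_bigr => i _ do rewrite sqZ exprMn -mulrA.
rewrite -scaler_suml -mulr_suml -/q.
by rewrite (_ : q * _ = 1) ?scale1r //; field.
Qed.
End Gram.

Lemma block_quadratic_form (K : comNzRingType) n (a t : K) (r v : 'rV[K]_n) (B : 'M_n) :
  (row_mx t%:M v *m (block_mx a%:M r r^T B : 'M_(1 + n)) *m (row_mx t%:M v)^T) 0 0 =
  t ^+ 2 * a + 2 * t * (r *m v^T) 0 0 + (v *m B *m v^T) 0 0.
Proof.
rewrite mul_row_block tr_row_mx mul_row_col !mulmxDl tr_scalar_mx.
rewrite !mul_mx_scalar !mul_scalar_mx -!scalemxAl.
have -> : v *m r^T = (r *m v^T)^T by rewrite trmx_mul trmxK.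
by rewrite !mxE eqxx mulr1n; ring.
Qed.

Lemma schur_entry (K : comNzRingType) (k : K) (X Y : 'M_1) :
  (k *: X - Y^T *m Y) 0 0 = k * X 0 0 - Y 0 0 ^+ 2.
Proof. by rewrite !mxE big_ord1 mxE expr2. Qed.

(** Evaluate at the minimiser [- b / a]. For [a = 0] and [b != 0], the affine function would take
    the value [-1]. *)
Lemma discriminant_le (R : realFieldType) (a b c : R) : 0 <= a ->
  (forall t, 0 <= t ^+ 2 * a + 2 * t * b + c) -> b ^+ 2 <= a * c.
Proof.
rewrite le_eqVlt => /orP[/eqP<- h|a0 h].
  have [->|b0] := eqVneq b 0; first by rewrite expr0n mul0r.
  have := h (- (c + 1) / (2 * b)).
  rewrite (_ : _ + _ = -1); last by field.
  by rewrite oppr_ge0 ler10.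
have := h (- b / a); rewrite (_ : _ + c = (a * c - b ^+ 2) / a); last by field; rewrite gt_eqF.
by rewrite pmulr_lge0 ?invr_gt0 // subr_ge0.
Qed.

(** * Symmetric elimination *)

Section PsdGram.
Variables (R : rcfType) (m : nat).
Local Notation L := {fraction {mpoly R[m]}}.

(* Symmetric elimination; the Schur complement is multiplied by the pivot [a] so
   that it stays polynomial. *)
Lemma gram_of_psd n (A : 'M[{mpoly R[m]}]_n) : A^T = A ->
  (forall c (u : 'rV_n), 0 <= (u *m map_mx (meval c) A *m u^T) 0 0) ->
  gram (map_mx (@tofrac {mpoly R[m]}) A).
Proof.
elim: n A => [|n IH] A Asym Apos.
  by exists [::]; rewrite big_nil [LHS]flatmx0.
pose A1 : 'M_(1 + n) := A; pose a := A 0 0; pose r : 'rV_n := @ursubmx _ 1 n 1 n A1.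
pose B : 'M_n := @drsubmx _ 1 n 1 n A1.
have AE : A = (block_mx a%:M r r^T B : 'M_(1 + n)).
  have ul : @ulsubmx _ 1 n 1 n A1 = a%:M.
    by rewrite [LHS]mx11_scalar !mxE; congr (A _ _)%:M; exact: val_inj.
  have dl : @dlsubmx _ 1 n 1 n A1 = r^T by rewrite /r trmx_ursub [A1^T]Asym.
  by rewrite -ul -dl -[LHS](@submxK _ 1 n 1 n A1).
have Bsym : B^T = B by rewrite /B trmx_drsub [A1^T]Asym.
have Apt c : map_mx (meval c) A =
    (block_mx (a.@[c])%:M (map_mx (meval c) r) (map_mx (meval c) r)^T (map_mx (meval c) B) : 'M_(1 + n)).
  by rewrite AE [LHS](@map_block_mx _ _ (meval c) 1 n 1 n) map_scalar_mx -map_trmx.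
have form c t (v : 'rV_n) : 0 <= t ^+ 2 * a.@[c] + 2 * t * (map_mx (meval c) r *m v^T) 0 0
    + (v *m map_mx (meval c) B *m v^T) 0 0.
  have := Apos c (row_mx t%:M v : 'rV_(1 + n)).
  by rewrite Apt [X in 0 <= X]block_quadratic_form.
have a_ge0 c : 0 <= a.@[c].
  by have := form c 1 0; rewrite trmx0 !mulmx0 !mxE; rewrite expr1n mul1r mulr0 !addr0.
have disc c (v : 'rV_n) : ((map_mx (meval c) r *m v^T) 0 0) ^+ 2 <=
    a.@[c] * (v *m map_mx (meval c) B *m v^T) 0 0.
  by apply: discriminant_le => // t; apply: form.
(* With a zero pivot, the discriminant inequality kills the rest of the first row. *)
have [a0|a0] := eqVneq a 0.
  have r0 : r = 0.
    apply/rowP => j; rewrite [RHS]mxE; apply: meval_eq0 => c.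
    have := disc c (delta_mx 0 j); rewrite a0 meval0 mul0r trmx_delta -colE mxE mxE.
    by rewrite real_exprn_even_le0 ?num_real //= => /eqP.
  rewrite AE a0 r0 [map_mx _ _](@map_block_mx _ _ (@tofrac _) 1 n 1 n) !(raddf0, trmx0, map_mx0).
  apply: gram_block; apply: IH => // c u.
  by have := form c 0 u; rewrite expr0n mulr0 !mul0r !add0r.
pose S : 'M_n := a *: B - r^T *m r.
have Ssym : S^T = S by rewrite /S linearB linearZ /= trmx_mul trmxK Bsym.
(* For the scaled Schur complement, nonnegativity of the form is the discriminant inequality. *)
have Spos c (u : 'rV_n) : 0 <= (u *m map_mx (meval c) S *m u^T) 0 0.
  have -> : u *m map_mx (meval c) S *m u^T = a.@[c] *: (u *m map_mx (meval c) B *m u^T) -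
      (map_mx (meval c) r *m u^T)^T *m (map_mx (meval c) r *m u^T).
    rewrite trmx_mul trmxK /S map_mxB map_mxZ map_mxM -map_trmx.
    by rewrite mulmxBr mulmxBl -scalemxAr -scalemxAl !mulmxA.
  by rewrite schur_entry subr_ge0 disc.
have gS := IH _ Ssym Spos.
have sa := artin a_ge0.
pose al : L := tofrac a.
have al0 : al != 0 by rewrite tofrac_eq0.
have sai : sos al^-1.
  have -> : al^-1 = al * al^-1 ^+ 2 by rewrite expr2 mulrA divff ?mul1r.
  by apply: sosM sa (sos_sq _).
(* With [w = (a, r)], the blocks of [w^T w] are [a ^+ 2], [a r], [a r^T] and [r^T r]; adding [S] in
   the last one gives [a A]. *)
have -> : map_mx (@tofrac _) A = al^-1 *:
    ((row_mx al%:M (map_mx (@tofrac _) r) : 'rV_(1 + n))^T *m row_mx al%:M (map_mx (@tofrac _) r)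
      + (block_mx 0 0 0 (map_mx (@tofrac _) S) : 'M_(1 + n))).
  rewrite AE [LHS](@map_block_mx _ _ (@tofrac _) 1 n 1 n) map_scalar_mx -map_trmx.
  rewrite tr_row_mx mul_col_row add_block_mx scale_block_mx !addr0 tr_scalar_mx.
  rewrite !mul_mx_scalar !mul_scalar_mx !scalerA mulVf // !scale1r.
  by rewrite /S map_mxB map_mxZ map_mxM -map_trmx addrC subrK scalerA mulVf // scale1r.
by apply: gramZ => //; apply: gramD (gram1 _) (gram_block gS).
Qed.
End PsdGram.

Theorem theorem1 (R : realType) (n m : nat) (hn : (1 <= n)%N) (hm : (1 <= m)%N)
    (A : 'M[{mpoly R[m]}]_n) (Asym : symmetric_mx A)
    (Apsd : forall c : 'I_m -> R, psd_mx (map_mx (meval c) A)) :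
  exists (k : nat) (B : 'I_k -> 'M[{fraction {mpoly R[m]}}]_n),
    (forall i : 'I_k, symmetric_mx (B i)) /\
    map_mx (@tofrac {mpoly R[m]}) A = \sum_(i < k) B i ^+ 2.
Proof.
have gA : gram (map_mx (@tofrac {mpoly R[m]}) A).
  by apply: gram_of_psd => // c u; have [hs he] := Apsd c; apply: psd_quadratic_form.
have [s [ssym ->]] := gram_sum_squares gA (@sum_sqr_eq0 R m).
exists (size s), (fun i => nth 0 s i); split=> [i|]; first by apply/ssym/mem_nth.
by rewrite (big_nth 0) big_mkord.
Qed.
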